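(* Let $N\ge 1$ be an integer, let $\Gamma$ be one of $\Gamma(N)$, $\Gamma_1(N)$, $\Gamma_0(N)$, and let $\alpha$ be an invariant of level $\Gamma$ that admits a good model. Then for every positive integer $m$ coprime to $N$ there exists the modular polynomial $\Phi_m^\alpha(X,Y)\in\mathbb{Q}[X,Y]$ of order $m$ for $\alpha$.
   Context: All elliptic curves are over $\mathbb{C}$. An enhanced elliptic curve of level $\Gamma(N)$ is a pair $(E,(P,Q))$ where $(P,Q)$ is a basis of $E[N]$ with Weil pairing $e_N(P,Q)=e^{2\pi i/N}$; of level $\Gamma_1(N)$ a pair $(E,P)$ with $P\in E[N]$ of order $N$; of level $\Gamma_0(N)$ a pair $(E,C)$ with $C\subset E[N]$ a cyclic subgroup of order $N$. We write $(E,* )$ generically. Two enhanced elliptic curves are isomorphic if there is an isomorphism of elliptic curves carrying one level structure to the other; $S$ denotes the set of isomorphism classes of enhanced elliptic curves of level $\Gamma$. An isogeny of degree $m$ from $(E,(P,Q))$ to $(E',(P',Q'))$ is an isogeny $\varphi:E\to E'$ of degree $m$ with $\varphi(P)=[m]P'$ and $\varphi(Q)=Q'$; from $(E,P)$ to $(E',P')$ one with $\varphi(P)=P'$; from $(E,C)$ to $(E',C')$ one with $\varphi(C)=C'$. It is cyclic if its kernel is cyclic. $\psi(m)=m\prod_{p\mid m}(1+1/p)$ (product over primes dividing $m$). An invariant of level $\Gamma$ is an injective map $\alpha:S\to\mathbb{C}$ together with $j_\alpha\in\mathbb{Q}(X)$ such that: $j(E)=j_\alpha(\alpha(E,* ))$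 for every $(E,* )$; and, writing $j_\alpha=J_1/J_0$ in lowest terms with $J_0,J_1\in\mathbb{Z}[X]$, we have $\deg J_1>\deg J_0$, $J_0(z)=0$ for all $z\in\mathbb{C}\setminus\operatorname{im}\alpha$, $J_0$ is primitive, and the leading coefficient of $J_1$ is not divisible by any prime not dividing $N$. A model of $\alpha$ is a choice, for each $z\in\operatorname{im}\alpha$, of an enhanced elliptic curve $(E_z,* )$ with $\alpha(E_z,* )=z$ and a function $x_z:E_z(\mathbb{C})\to\mathbb{C}\cup\{\infty\}$ such that (1) $x_z$ is surjective; (2) $x_z^{-1}(\infty)\subset E_z[N]$; (3) for $R_1,R_2\in E_z(\mathbb{C})$, $x_z(R_1)=x_z(R_2)$ iff $R_1=R_2+R_\infty$ or $R_1=-R_2+R_\infty$ for some $R_\infty\in x_z^{-1}(\infty)$. It is a good model if moreover: (a) for every integer $m$ there is a rational function $M_m(X;Y)\in\mathbb{Z}(X,Y)$ with $x_z([m]R)=M_m(z;x_z(R))$ for all $z\in\operatorname{im}\alpha$, $R\in E_z(\mathbb{C})$; (b) for every positive integer $m$ there is $\Psi_m(X;Y)\in\mathbb{Z}[X,Y]$ whose leading coefficient as a polynomial in $Y$ is an integer not divisible by any prime not dividing $m$, such that for all $z\in\operatorname{im}\alpha$ and $R\in E_z(\mathbb{C})\setminus x_z^{-1}(\infty)$, $\Psi_m(z;x_z(R))=0$ iff $x_z([m]R)=x_z(0_{E_z})$; (c) for every positive integer $m$ prime to $N$ there is $V_m\in\mathbb{Z}[1/m][X,Y_1,\dots,Y_{m-1}]$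 such that whenever $z,z'\in\operatorname{im}\alpha$ and there is a cyclic isogeny $\varphi$ of degree $m$ from $(E_z,* )$ to $(E_{z'},* )$, then $z'=V_m(z;x_z(R),x_z([2]R),\dots,x_z([m-1]R))$ for every generator $R$ of $\ker\varphi$. For a positive integer $m$ prime to $N$, the modular polynomial of order $m$ for $\alpha$ is a polynomial $\Phi_m^\alpha(X,Y)\in\mathbb{C}[X,Y]$, monic of degree $\psi(m)$ in $Y$, such that for all enhanced elliptic curves $(E,* ),(E',* )$ of level $\Gamma$: $\Phi_m^\alpha(\alpha(E,* ),\alpha(E',* ))=0$ iff there is a cyclic isogeny of degree $m$ from $(E,* )$ to $(E',* )$. *)

(* Defs.v *)
From HB Require Import structures.
From mathcomp Require Import all_boot all_order all_algebra.
From mathcomp Require Import generic_quotient ring_quotient fraction.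
From mathcomp Require Import all_classical all_reals all_analysis.
From mathcomp Require Import complex.
(* Not imported: its notations clash with those of mathcomp-analysis. *)
From mathcomp Require mpoly.

Set Implicit Arguments.
Unset Strict Implicit.
Unset Printing Implicit Defensive.

Import Order.TTheory GRing.Theory Num.Theory numFieldNormedType.Exports.

Local Open Scope classical_set_scope.
Local Open Scope ring_scope.

(* The complex numbers are [R[i]] for a [realType] [R].  An elliptic curve over
   them is a complex torus C/L, its morphisms are the holomorphic group
   homomorphisms, and its invariants are the classical analytic ones
   (conventions of Diamond--Shurman, A First Course in Modular Forms,
   sections 1.3--1.5). *)

(* The lattice L = Z w1 + Z w2 with w1 / w2 in the upper half plane; the
   orientation of the basis matters for the Weil pairing only. *)
Record lattice (R : realType) := Lattice {
  w1 : R[i];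
  w2 : R[i];
  lattice_oriented : 0 < complex.Im (w1 / w2) }.

Definition lattice_pred (R : realType) (L : lattice R) : {pred R[i]} :=
  fun z => `[< exists a b : int, z = a%:~R * w1 L + b%:~R * w2 L >].

Lemma lattice_zmod_closed (R : realType) (L : lattice R) :
  zmod_closed (lattice_pred L).
Proof.
split=> [|z z' /asboolP[a [b ->]] /asboolP[c [d ->]]]; apply/asboolP.
  by exists 0, 0; rewrite !mul0r addr0.
exists (a - c), (b - d).
by rewrite !rmorphB /= !mulrBl opprD addrACA.
Qed.

HB.instance Definition _ (R : realType) (L : lattice R) :=
  GRing.isZmodClosed.Build R[i] (lattice_pred L) (@lattice_zmod_closed R L).

(* The group E(C) = C/L. *)
Definition curve (R : realType) (E : lattice R) : zmodType :=
  Quotient.quot (lattice_pred E).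

Definition torus_proj (R : realType) (E : lattice R) (z : R[i]) : curve E :=
  (\pi_(Quotient.quot (lattice_pred E)) z)%qT.

(* The Eisenstein series, i.e. the sum of w ^- k over the nonzero w in L; it is
   only used for k = 4 and k = 6, where the family is absolutely summable, so
   that summing over growing squares is harmless. *)
Definition eisenstein (R : realType) (L : lattice R) (k : nat) : R[i] :=
  limn (fun n : nat =>
    \sum_(a < n.*2.+1) \sum_(b < n.*2.+1 | (a != n :> nat) || (b != n :> nat))
      ((a%:Z - n%:Z)%:~R * w1 L + (b%:Z - n%:Z)%:~R * w2 L) ^- k : R[i]^o).

Definition j_invariant (R : realType) (E : lattice R) : R[i] :=
  let g2 := 60 * eisenstein E 4 in
  let g3 := 140 * eisenstein E 6 in
  1728 * g2 ^+ 3 / (g2 ^+ 3 - 27 * g3 ^+ 2).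

(* A map between tori is holomorphic iff it lifts to an entire function. *)
Definition holomorphic_map (R : realType) (E E' : lattice R)
    (phi : curve E -> curve E') : Prop :=
  exists f : R[i]^o -> R[i]^o,
    (forall z, derivable f z 1) /\
    (forall z, phi (torus_proj E z) = torus_proj E' (f z)).

Definition holomorphic_hom (R : realType) (E E' : lattice R)
    (phi : curve E -> curve E') : Prop :=
  holomorphic_map phi /\ {morph phi : P Q / P + Q}.

Definition isogeny (R : realType) (E E' : lattice R)
    (phi : curve E -> curve E') : Prop :=
  holomorphic_hom phi /\ exists P, phi P != 0.

Definition isomorphism (R : realType) (E E' : lattice R)
    (phi : curve E -> curve E') : Prop :=
  holomorphic_hom phi /\
  exists psi : curve E' -> curve E,
    [/\ holomorphic_hom psi, cancel phi psi & cancel psi phi].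

Definition ker (R : realType) (E E' : lattice R) (phi : curve E -> curve E') :
  set (curve E) := [set P | phi P = 0].

(* Isogenies are unramified coverings: the degree is the number of points of
   the fibre above 0. *)
Definition has_degree (R : realType) (E E' : lattice R)
    (phi : curve E -> curve E') (m : nat) : Prop :=
  (ker phi #= `I_m)%card.

Definition cyclic_span (R : realType) (E : lattice R) (P : curve E) :
  set (curve E) := [set P *~ k | k in [set: int]].

Definition torsion (R : realType) (E : lattice R) (N : nat) : set (curve E) :=
  [set P | P *+ N = 0].

Definition has_order (R : realType) (E : lattice R) (P : curve E) (n : nat) :
  Prop := (0 < n)%N /\ forall k : nat, P *+ k = 0 <-> (n %| k)%N.

Definition is_torsion_basis (R : realType) (E : lattice R) (N : nat)
    (P Q : curve E) : Prop :=
  [/\ torsion N P, torsion N Q &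
      forall T, torsion N T ->
        exists! ab : 'I_N * 'I_N, T = P *+ ab.1 + Q *+ ab.2].

Definition expi (R : realType) (t : R) : R[i] := (cos t +i* sin t)%C.

(* [weil_pairing N P Q e] : e_N(P, Q) = e, that is e = exp(2 i pi det g / N)
   when (P; Q) = g (w1 / N; w2 / N) with g a 2 x 2 integer matrix. *)
Definition weil_pairing (R : realType) (E : lattice R) (N : nat)
    (P Q : curve E) (e : R[i]) : Prop :=
  exists a b c d : int,
    [/\ P = torus_proj E ((a%:~R * w1 E + b%:~R * w2 E) / N%:R),
        Q = torus_proj E ((c%:~R * w1 E + d%:~R * w2 E) / N%:R) &
        e = expi (2 * pi * (a * d - b * c)%:~R / N%:R)].

Inductive level := Gamma | Gamma1 | Gamma0.

Definition level_data (R : realType) (G : level) (E : lattice R) : Type :=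
  match G with
  | Gamma => (curve E * curve E)%type
  | Gamma1 => curve E
  | Gamma0 => set (curve E)
  end.

Definition is_level_structure (R : realType) (G : level) (N : nat)
    (E : lattice R) : level_data G E -> Prop :=
  match G return level_data G E -> Prop with
  | Gamma => fun PQ => is_torsion_basis N PQ.1 PQ.2 /\
                       weil_pairing N PQ.1 PQ.2 (expi (2 * pi / N%:R))
  | Gamma1 => fun P => has_order P N
  | Gamma0 => fun C => exists2 P, has_order P N & C = cyclic_span P
  end.

Record enhanced (R : realType) (G : level) (N : nat) := Enhanced {
  ecurve :> lattice R;
  estr : level_data G ecurve;
  estrP : is_level_structure N estr }.

(* The condition that an isogeny of degree [m] has to satisfy on the level
   structures; only the case of [Gamma] depends on [m]. *)
Definition maps_level (R : realType) (G : level) (m : nat) (E E' : lattice R)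
    (phi : curve E -> curve E') : level_data G E -> level_data G E' -> Prop :=
  match G return level_data G E -> level_data G E' -> Prop with
  | Gamma => fun PQ PQ' => phi PQ.1 = PQ'.1 *+ m /\ phi PQ.2 = PQ'.2
  | Gamma1 => fun P P' => phi P = P'
  | Gamma0 => fun C C' => phi @` C = C'
  end.

Definition enhanced_iso (R : realType) (G : level) (N : nat)
    (x y : enhanced R G N) : Prop :=
  exists phi : curve x -> curve y,
    isomorphism phi /\ maps_level 1 phi (estr x) (estr y).

Definition cyclic_isogeny (R : realType) (G : level) (N m : nat)
    (x y : enhanced R G N) (phi : curve x -> curve y) : Prop :=
  [/\ isogeny phi, has_degree phi m, exists P, ker phi = cyclic_span P &
      maps_level m phi (estr x) (estr y)].

Definition int_poly (K : nzRingType) (p : {poly int}) : {poly K} :=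
  map_poly intr p.

(* [lowest_terms f p q] : f = p / q in lowest terms with p, q in Z[X] and q
   primitive. *)
Definition lowest_terms (f : {fraction {poly rat}}) (p q : {poly int}) : Prop :=
  [/\ f = tofrac (int_poly rat p) / tofrac (int_poly rat q),
      q != 0, coprimep (int_poly rat p) (int_poly rat q) &
      (`|zcontents q| = 1)%R].

(* An injective map on the set S of isomorphism classes is a map on enhanced
   elliptic curves whose equality relation is isomorphism. *)
Record modular_invariant (R : realType) (G : level) (N : nat) :=
  ModularInvariant {
  inv_fun :> enhanced R G N -> R[i];
  jfrac : {fraction {poly rat}};
  J1 : {poly int};
  J0 : {poly int};
  inv_inj : forall x y, inv_fun x = inv_fun y <-> enhanced_iso x y;
  jfracE : lowest_terms jfrac J1 J0;
  inv_j : forall x,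
    (int_poly R[i] J0).[inv_fun x] != 0 /\
    j_invariant x =
      (int_poly R[i] J1).[inv_fun x] / (int_poly R[i] J0).[inv_fun x];
  deg_J : (size J0 < size J1)%N;
  J0_root : forall z, ~ range inv_fun z -> (int_poly R[i] J0).[z] = 0;
  lead_J1 : forall p : nat, prime p -> ~~ (p %| N)%N ->
    ~~ (p%:Z %| lead_coef J1)%Z }.

(* Polynomials in X, Y are polynomials in Y with coefficients in Z[X]; this is
   A(z, Y). *)
Definition specialize (R : realType) (z : R[i]) (A : {poly {poly int}}) :
  {poly R[i]} := map_poly (fun c : {poly int} => (int_poly R[i] c).[z]) A.

(* The value of the rational function f / g at a point of the projective line;
   [None] is the point at infinity. *)
Definition ratfun_value (K : fieldType) (f g : {poly K}) (y : option K) :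
    option K :=
  let p := f %/ gcdp f g in
  let q := g %/ gcdp f g in
  match y with
  | Some a => if q.[a] == 0 then None else Some (p.[a] / q.[a])
  | None => if (size q < size p)%N then None
            else Some (p`_(size q).-1 / lead_coef q)
  end.

(* w = M(z; y), where M(z; Y) is the specialization of M(X; Y) at X = z,
   evaluated as a rational function of Y. *)
Definition specialized_value (R : realType) (M : {fraction {poly {poly int}}})
    (z : R[i]) (y w : option R[i]) : Prop :=
  exists A B : {poly {poly int}},
    [/\ M = tofrac A / tofrac B, specialize z B != 0 &
        w = ratfun_value (specialize z A) (specialize z B) y].

(* Only the values of [mcurve] and [mx] at points of the image of [alpha]
   are meaningful. *)
Record model (R : realType) (G : level) (N : nat)
    (alpha : modular_invariant R G N) := Model {
  mcurve : R[i] -> enhanced R G N;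
  mx : forall z : R[i], curve (mcurve z) -> option R[i];
  mcurveP : forall z, range alpha z -> alpha (mcurve z) = z;
  mx_surj : forall z, range alpha z -> forall y, exists T, @mx z T = y;
  mx_infty : forall z, range alpha z -> forall T, @mx z T = None ->
    torsion N T;
  mx_eq : forall z, range alpha z -> forall T1 T2,
    @mx z T1 = @mx z T2 <->
    exists2 T, @mx z T = None & T1 = T2 + T \/ T1 = - T2 + T }.

(* By [mx_eq] (with T1 = T2), 0 is a point at infinity, so that the
   multiplication by 0 corresponds to the constant infinity, which is not an
   element of Z(X, Y); whence the condition m != 0. *)
Definition multiplication_rational (R : realType) (G : level) (N : nat)
    (alpha : modular_invariant R G N) (mo : model alpha) : Prop :=
  forall m : int, m != 0 ->
  exists M : {fraction {poly {poly int}}},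
  forall z, range alpha z -> forall T : curve (mcurve mo z),
    specialized_value M z (mx T) (mx (T *~ m)).

Definition division_polynomials (R : realType) (G : level) (N : nat)
    (alpha : modular_invariant R G N) (mo : model alpha) : Prop :=
  forall m : nat, (0 < m)%N ->
  exists Psi : {poly {poly int}},
    (exists2 c : int, lead_coef Psi = c%:P &
       forall p : nat, prime p -> ~~ (p %| m)%N -> ~~ (p%:Z %| c)%Z) /\
    forall z, range alpha z -> forall (T : curve (mcurve mo z)) (y : R[i]),
      mx T = Some y ->
      ((specialize z Psi).[y] = 0 <->
       mx (T *+ m) = mx (0 : curve (mcurve mo z))).

Definition inv_int (m : nat) (c : rat) : Prop :=
  exists k : nat, c * m%:R ^+ k \is a Num.int.

(* The variable of index 0 of [V] is X, the one of index k > 0 is Y_k.  The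
   points kT with 0 < k < m are not N-torsion since m is prime to N, so that
   their x is finite. *)
Definition isogeny_polynomials (R : realType) (G : level) (N : nat)
    (alpha : modular_invariant R G N) (mo : model alpha) : Prop :=
  forall m : nat, (0 < m)%N -> coprime m N ->
  exists V : mpoly.mpoly m rat,
    (forall mon, inv_int m (mpoly.mcoeff mon V)) /\
    forall z z', range alpha z -> range alpha z' ->
    forall phi : curve (mcurve mo z) -> curve (mcurve mo z'),
      cyclic_isogeny m phi ->
    forall T, ker phi = cyclic_span T ->
    forall v : 'I_m -> R[i],
      (forall k : 'I_m,
         if k == 0 :> nat then v k = z else mx (T *+ k) = Some (v k)) ->
      z' = mpoly.meval v (mpoly.map_mpoly ratr V).

Definition good_model (R : realType) (G : level) (N : nat)
    (alpha : modular_invariant R G N) (mo : model alpha) : Prop :=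
  [/\ multiplication_rational mo, division_polynomials mo &
      isogeny_polynomials mo].

Definition psi (m : nat) : rat :=
  m%:R * \prod_(p <- primes m) (1 + p%:R^-1).

(* [Phi] is a polynomial in Y with coefficients in C[X]. *)
Definition is_modular_polynomial (R : realType) (G : level) (N : nat)
    (alpha : modular_invariant R G N) (m : nat) (Phi : {poly {poly R[i]}}) :
    Prop :=
  [/\ Phi \is monic, (size Phi).-1%:R = psi m &
      forall x y : enhanced R G N,
        Phi.[(alpha y)%:P].[alpha x] = 0 <->
        exists phi : curve x -> curve y, cyclic_isogeny m phi].

(* Main.v *)
Require Import Defs.
From mathcomp Require Import all_boot all_order all_algebra.
From mathcomp Require Import reals complex.
From HB Require Import structures.
From mathcomp Require Import separable ring zify.

(** For [z] in the image of [alpha], which is the complement of the zeros of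
    [J0], the x-coordinates of the nonzero [m]-torsion points of [E_z] are the
    roots of [Psi_m(z; Y)], and their number does not depend on [z].  Hence the
    squarefree part of [Psi_m] over [Q(X)] specializes at every such [z] to a
    product of distinct linear factors; its coefficients are in [Q[X]], because
    an element of [Q(X)] that stays bounded near every point is a polynomial.
    Dividing by the analogous polynomial for the orders [d < m] leaves [h(X, Y)]
    with [h(z, Y) = \prod (Y - x_z(P))] over the points [P] of exact order [m],
    up to sign.

    The invariant [z'_P] of the quotient of [E_z] by [P] is [V_m] evaluated at
    the [x_z(kP)].  The denominator of [M_k] can be taken to be [b(X) Psi_k^n]
    with [b] without zeros on the image of [alpha], so that [z'_P] is
    [H(z, x_z(P)) / D(z, x_z(P))] with [D] nonzero at all the points needed, for
    every [z] and not only for generic ones.  The norm of [D Y - H] along [h],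
    divided by its leading coefficient, has bounded roots, hence coefficients
    in [Q[X]].  It is, up to the identification of [P] with [- P], a
    [totient m]-th power at each [z], and the root of this power is [Phi_m]. *)

Set Implicit Arguments.
Unset Strict Implicit.
Unset Printing Implicit Defensive.

Import Order.TTheory GRing.Theory Num.Theory.

Local Open Scope ring_scope.

(** * Specialization of polynomials over Q[X] *)

Section Specialization.
Variable C : numClosedFieldType.
Implicit Types (z : C) (c : {poly rat}) (P Q K : {poly {poly rat}}).

(** [is_modular_polynomial] constrains every point of the image of [alpha], while gcds, squarefree
    parts and fractions over Q(X) specialize well only outside finitely many values of X; this gap
    shapes the proof. Moreover the curves [mcurve mo z] are arbitrary choices, with no continuity in
    z, so that only symmetric expressions in the torsion points of one curve can be compared with
    polynomials. Boundedness has two sources. The leading coefficient of Psi_m is a nonzero integer,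
    so the x-coordinates of torsion points are roots of a monic polynomial; and V_m is a polynomial,
    so z'_P stays bounded along with z and these coordinates. The fraction in z and x_z(P) serves
    the other purpose: it makes the norm available over Q[X]. The degree psi(m) arises as J_2(m) /
    totient m, where Jordan's J_2(m) counts the elements of order m in (Z/m)^2. *)

Definition ev z : {poly rat} -> C := horner_eval z \o map_poly ratr.
HB.instance Definition _ z := GRing.RMorphism.copy (ev z)
  (horner_eval z \o map_poly ratr).

Definition spec z : {poly {poly rat}} -> {poly C} := map_poly (ev z).
HB.instance Definition _ z := GRing.RMorphism.copy (spec z) (map_poly (ev z)).

Arguments ev : simpl never.
Arguments spec : simpl never.

Lemma evE z c : ev z c = (map_poly ratr c).[z]. Proof. by []. Qed.

Lemma spec_coef z P i : (spec z P)`_i = ev z P`_i.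
Proof. by rewrite coef_map. Qed.

Lemma specC z c : spec z c%:P = (ev z c)%:P.
Proof. exact: map_polyC. Qed.

Lemma specZ z c P : spec z (c *: P) = ev z c *: spec z P.
Proof. exact: map_polyZ. Qed.

Lemma spec_deriv z P : spec z P^`() = (spec z P)^`().
Proof. by rewrite deriv_map. Qed.

Lemma evC z (a : rat) : ev z a%:P = ratr a.
Proof. by rewrite evE map_polyC hornerC. Qed.

Lemma size_spec z P : ev z (lead_coef P) != 0 -> size (spec z P) = size P.
Proof. exact: size_poly_eq. Qed.

Lemma lead_coef_spec z P :
  ev z (lead_coef P) != 0 -> lead_coef (spec z P) = ev z (lead_coef P).
Proof. by move=> h; rewrite lead_coefE size_spec // spec_coef. Qed.

Lemma spec_monic z P : P \is monic -> spec z P \is monic.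
Proof. exact: monic_map. Qed.

Lemma size_spec_monic z P : P \is monic -> size (spec z P) = size P.
Proof. by move=> /monicP mP; rewrite size_spec // mP rmorph1 oner_neq0. Qed.

(** A nonzero [c] has fewer than [size c] roots, so one of the [size c] distinct points
    [z0 + e / k.+1%:R] is not among them. *)
Lemma ev_neq0_near c : c != 0 -> forall z0 (e : C), 0 < e ->
  exists2 z, `|z - z0| <= e & ev z c != 0.
Proof.
move=> c0 z0 e e0; pose f k : C := z0 + e / k.+1%:R.
have finj : injective f.
  move=> i j /addrI/(mulfI (lt0r_neq0 e0))/invr_inj/eqP.
  by rewrite eqr_nat => /eqP[].
pose rs := map f (iota 0 (size c)).
have [/allP h|/allPn[z /mapP[k _ ->] h]] := boolP (all (root (map_poly ratr c)) rs).
  have : (size rs < size (map_poly (ratr : rat -> C) c))%N.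
    apply: max_poly_roots; rewrite ?map_poly_eq0 //; first exact/allP.
    by rewrite map_inj_uniq ?iota_uniq.
  by rewrite size_map size_iota size_map_poly ltnn.
exists (f k) => //; rewrite /f addrC addKr ger0_norm.
  by rewrite ler_pdivrMr ?ltr0n // ler_peMr ?ler1n // ltW.
by rewrite divr_ge0 // ltW.
Qed.

Lemma ev_neq0_ex c : c != 0 -> exists z, ev z c != 0.
Proof. by move=> /ev_neq0_near-/(_ 0 1 ltr01)[z _ h]; exists z. Qed.

Lemma ev_eq0 c a : a != 0 -> (forall z, ev z a != 0 -> ev z c = 0) -> c = 0.
Proof.
move=> a0 h; apply/eqP/negPn/negP => c0.
have [z] := ev_neq0_ex (mulf_neq0 a0 c0); rewrite rmorphM /= mulf_eq0 negb_or.
by case/andP => /h ->; rewrite eqxx.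
Qed.

Lemma spec_eq0 P a : a != 0 -> (forall z, ev z a != 0 -> spec z P = 0) -> P = 0.
Proof.
move=> a0 h; apply/polyP => i; rewrite coef0; apply: (ev_eq0 a0) => z /h Pz.
by rewrite -spec_coef Pz coef0.
Qed.

(** Over the ring [{poly rat}], [%|] is pseudo-divisibility, that is, divisibility over Q(X). Where
    [lead_coef K] does not vanish, the pseudo-remainder specializes to a multiple of [spec z K] of
    smaller degree, hence to 0; as this happens at all generic z, it is 0. *)
Lemma spec_dvd K P a : a != 0 ->
  (forall z, ev z a != 0 -> spec z K %| spec z P) -> K %| P.
Proof.
move=> a0 h; rewrite /dvdp; apply/eqP.
have [K0|K0] := eqVneq K 0.
  rewrite K0 modp0; apply: (spec_eq0 a0) => z /h.
  by rewrite K0 rmorph0 => /dvd0pP.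
have a1 : a * lead_coef K != 0 by rewrite mulf_neq0 ?lead_coef_eq0.
apply: (spec_eq0 a1) => z; rewrite rmorphM /= mulf_eq0 negb_or => /andP[az lz].
have /(congr1 (spec z)) := Pdiv.Idomain.divp_eq P K.
rewrite specZ rmorphD rmorphM /= => e.
have hdv : spec z K %| spec z (P %% K).
  by rewrite -(dvdp_addr _ (dvdp_mull (spec z (P %/ K)) (dvdpp _))) -e dvdpZr ?h //
    rmorphXn expf_neq0.
apply/eqP/negPn/negP => nz; have := dvdp_leq nz hdv.
rewrite size_spec // leqNgt => /negP; apply.
by apply: leq_ltn_trans (size_poly _ _) _; rewrite ltn_modp.
Qed.

(** For a monic divisor pseudo-division is true division, so generic divisibility propagates to
    every z. *)
Lemma spec_dvd_monic K P a : a != 0 -> K \is monic ->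
  (forall z, ev z a != 0 -> spec z K %| spec z P) -> exists Q, P = Q * K.
Proof.
move=> a0 mK /(spec_dvd a0); rewrite Pdiv.Idomain.dvdp_eq.
rewrite (eqP mK) expr1n scale1r => /eqP ->.
by exists (P %/ K).
Qed.

Lemma poly_bounded c (B : C) : exists2 M : C, 0 <= M &
  forall z, `|z| <= B -> `|ev z c| <= M.
Proof.
pose B' := `|B|; exists (\sum_(i < size c) `|ratr c`_i| * B' ^+ i : C).
  by apply: sumr_ge0 => i _; rewrite mulr_ge0 ?exprn_ge0 ?normr_ge0.
move=> z zB; rewrite evE horner_coef size_map_poly.
apply: le_trans (ler_norm_sum _ _ _) _; apply: ler_sum => i _.
have zB' : `|z| <= B' by rewrite (le_trans zB) // /B' ger0_norm // (le_trans _ zB).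
by rewrite normrM coef_map normrX ler_wpM2l // lerXn2r ?nnegrE // (le_trans _ zB').
Qed.

Lemma poly_bounded2 P (B : C) : exists2 M : C, 0 <= M &
  forall z, `|z| <= B -> forall i, `|ev z P`_i| <= M.
Proof.
suff [M M0 h] : exists2 M : C, 0 <= M &
  forall z, `|z| <= B -> forall i, (i < size P)%N -> `|ev z P`_i| <= M.
  exists M => // z zB i; have [/h-> //|ip] := ltnP i (size P).
  by rewrite nth_default // rmorph0 normr0.
elim: (size P) => [|n [M M0 h]]; first by exists 0.
have [M' M'0 h'] := poly_bounded P`_n B.
exists (M + M') => [|z zB i]; first exact: addr_ge0.
rewrite ltnS leq_eqVlt => /orP[/eqP ->|/h].
  by rewrite (le_trans (h' _ zB)) // lerDr.
by move=> /(_ z zB) h1; rewrite (le_trans h1) // lerDl.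
Qed.

Lemma ev_lipschitz c z0 : exists2 M : C, 0 <= M &
  forall z, `|z - z0| <= 1 -> `|ev z c - ev z0 c| <= M * `|z - z0|.
Proof.
elim/poly_ind: c => [|p a [M M0 IH]].
  by exists 0 => // z _; rewrite !rmorph0 subrr normr0 mul0r.
have [M1 M10 h1] := poly_bounded p (`|z0| + 1).
exists (M1 + `|z0| * M) => [|z hz].
  by rewrite addr_ge0 ?mulr_ge0.
have zB : `|z| <= `|z0| + 1.
  by rewrite -[z](subrK z0) (le_trans (ler_normD _ _)) // addrC lerD2l.
have -> : ev z (p * 'X + a%:P) - ev z0 (p * 'X + a%:P) =
  ev z p * (z - z0) + z0 * (ev z p - ev z0 p).
  rewrite !rmorphD !rmorphM /= !evE !map_polyX !hornerX !map_polyC /= !hornerC.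
  rewrite opprD addrACA subrr addr0 !mulrBr.
  by rewrite addrA [z0 * _]mulrC subrK [z0 * _]mulrC.
rewrite (le_trans (ler_normD _ _)) // !normrM mulrDl lerD //.
  by rewrite ler_wpM2r // h1.
by rewrite -mulrA ler_wpM2l // IH.
Qed.

(** A root z0 of the reduced denominator [q1] would be a pole: the bound makes [p1] small near z0,
    where it does not vanish. The zeros of [a] can be left out because generic points come
    arbitrarily close to z0. *)
Lemma dvdp_of_bounded (p q a : {poly rat}) : a != 0 -> q != 0 ->
  (forall B : C, exists M : C, forall z, `|z| <= B -> ev z a != 0 ->
     `|ev z p| <= M * `|ev z q|) ->
  q %| p.
Proof.
move=> a0 q0 h.
pose d := gcdp p q; pose p1 := p %/ d; pose q1 := q %/ d.
have d0 : d != 0 by rewrite gcdp_eq0 (negPf q0) andbF.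
have pE : p = p1 * d by rewrite divpK ?dvdp_gcdl.
have qE : q = q1 * d by rewrite divpK ?dvdp_gcdr.
have cop : coprimep p1 q1.
  by rewrite coprimep_div_gcd // q0 orbT.
suff : (size q1 <= 1)%N.
  rewrite pE qE => sq; rewrite dvdp_mul2r //.
  have q10 : q1 != 0 by apply: contraNneq q0 => e; rewrite qE e mul0r.
  have /eqP/size_poly1P[k k0 ->] : size q1 = 1%N.
    by apply/eqP; rewrite eqn_leq sq size_poly_gt0.
  by rewrite dvdpE -dvdpE -[k%:P]mulr1 mul_polyC dvdpZl // dvd1p.
rewrite leqNgt; apply/negP => sq1.
have [z0 rz0] : exists z0, ev z0 q1 = 0.
  have [|z0] := closed_rootP (map_poly (ratr : rat -> C) q1) _.
    by rewrite size_map_poly neq_ltn sq1 orbT.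
  by move/rootP => ?; exists z0.
have [u] := Bezout_eq1_coprimepP _ _ cop => uE.
have p1z0 : ev z0 p1 != 0.
  apply/eqP => pz0; move: (congr1 (ev z0) uE).
  rewrite rmorphD !rmorphM /= pz0 rz0 !mulr0 addr0 rmorph1 => /eqP.
  by rewrite eq_sym oner_eq0.
have [M hM] := h (`|z0| + 1).
have {hM} hM : forall z, `|z - z0| <= 1 -> ev z (a * d) != 0 ->
    `|ev z p1| <= `|M| * `|ev z q1|.
  move=> z hz; rewrite rmorphM /= mulf_eq0 negb_or => /andP[az dz].
  have : `|ev z p| <= M * `|ev z q|.
    apply: hM => //.
    by rewrite -[z](subrK z0) (le_trans (ler_normD _ _)) // addrC lerD2l.
  rewrite pE qE !rmorphM /= !normrM mulrA ler_pM2r ?normr_gt0 // => hh.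
  have [q1z|q1z] := eqVneq (ev z q1) 0.
    by move: hh; rewrite q1z normr0 !mulr0 => hh.
  have M0 : 0 <= M by rewrite -(pmulr_lge0 M (_ : 0 < `|ev z q1|)) ?normr_gt0 //
    (le_trans _ hh).
  by rewrite (ger0_norm M0).
have [L1 L10 hL1] := ev_lipschitz p1 z0.
have [L2 L20 hL2] := ev_lipschitz q1 z0.
have pos : 0 < `|ev z0 p1| by rewrite normr_gt0.
set L := L1 + `|M| * L2.
have L0 : 0 <= L by rewrite addr_ge0 ?mulr_ge0.
have L1p : 0 < L + 1 by rewrite ltr_wpDl.
(* Both Lipschitz bounds hold within distance 1 of z0; within [e] they give |p1(z0)| <= L e <
   |p1(z0)|. The denominator [L + 1] covers the case L = 0. *)
pose e : C := Num.min 1 (`|ev z0 p1| / (L + 1)).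
have ad0 : a * d != 0 by rewrite mulf_neq0.
have e0 : 0 < `|ev z0 p1| / (L + 1) by rewrite divr_gt0.
have cmp : 1 >=< `|ev z0 p1| / (L + 1).
  by rewrite real_comparable ?realE ?ler01 // ltW ?orbT.
have ep : 0 < e by rewrite comparable_lt_min // ltr01.
have [z hz adz] := ev_neq0_near ad0 z0 ep.
have hz1 : `|z - z0| <= 1.
  by rewrite (le_trans hz) // comparable_ge_min // lexx.
have : `|ev z0 p1| <= L * e.
  have -> : ev z0 p1 = ev z p1 - (ev z p1 - ev z0 p1) by rewrite opprB addrC subrK.
  rewrite (le_trans (ler_normB _ _)) // addrC mulrDl lerD //.
    by rewrite (le_trans (hL1 _ hz1)) // ler_wpM2l.
  rewrite (le_trans (hM _ hz1 adz)) // -mulrA ler_wpM2l //.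
  have := hL2 _ hz1; rewrite rz0 subr0 => h2.
  by rewrite (le_trans h2) // ler_wpM2l.
move=> h1.
have h2 : L * e <= L * (`|ev z0 p1| / (L + 1)).
  by rewrite ler_wpM2l // comparable_ge_min // lexx orbT.
have := le_trans h1 h2; rewrite mulrCA -[X in X <= _]mulr1 ler_pM2l //.
by rewrite ler_pdivlMr // mul1r gerDl ler10.
Qed.

End Specialization.

(** * Families of roots with rational coefficients *)

Section Families.
Variable C : numClosedFieldType.
Implicit Types (z : C) (c : {poly rat}) (P Q K : {poly {poly rat}}).

(** Cauchy's bound: for |y| > 1, isolate the leading term and compare after dividing by |y|^(n-1),
    where n is the degree. *)
Lemma monic_root_bound (p : {poly C}) y : p \is monic -> root p y ->
  `|y| <= 1 + \sum_(i < (size p).-1) `|p`_i|.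
Proof.
move=> mp /rootP; have sp : size p = (size p).-1.+1.
  by rewrite prednK // size_poly_gt0 monic_neq0.
rewrite horner_coef sp big_ord_recr /= -lead_coefE (monicP mp) mul1r.
set n := (size p).-1 => /eqP; rewrite addrC addr_eq0 => /eqP e.
have S0 : 0 <= \sum_(i < n) `|p`_i| by apply: sumr_ge0.
have [y1|y1] := real_leP (normr_real y) (real1 C); first by rewrite ler_wpDr.
rewrite ler_wpDl // -(ler_pM2r (_ : 0 < `|y| ^+ n.-1)) ?exprn_gt0 ?(lt_trans ltr01) //.
case en : n e S0 => [|k] e S0 /=.
  by move/eqP: e; rewrite expr0 big_ord0 oppr0 oner_eq0.
rewrite -exprS -normrX e normrN mulr_suml (le_trans (ler_norm_sum _ _ _)) //.
apply: ler_sum => i _; rewrite normrM normrX ler_wpM2l // ler_weXn2l ?(ltW y1) //.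
by rewrite -ltnS.
Qed.

Lemma coef_prod_bound (r : seq C) (B : C) : (forall x, x \in r -> `|x| <= B) ->
  0 <= B -> forall i, `|(\prod_(x <- r) ('X - x%:P))`_i| <= (1 + B) ^+ size r.
Proof.
move=> + B0; elim: r => [|x r IH] hB i.
  by rewrite big_nil coef1; case: eqP => _; rewrite ?normr1 ?normr0 ?ler01 ?lexx.
have h y : y \in r -> `|y| <= B by move=> yr; rewrite hB // in_cons yr orbT.
rewrite big_cons mulrBl coefB coefXM coefCM /= exprS mulrDl mul1r.
rewrite (le_trans (ler_normB _ _)) // lerD //.
  by case: eqP => _; rewrite ?normr0 ?exprn_ge0 ?addr_ge0 // IH.
by rewrite normrM ler_pM // ?hB ?mem_head // IH.
Qed.

(** The bound depends on [B] only, so it stays uniform when z approaches a zero of [a]. *)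
Definition locally_bounded (a : {poly rat}) (F : C -> seq C) := forall B : C,
  exists M : C, forall z, `|z| <= B -> ev z a != 0 -> forall x, x \in F z -> `|x| <= M.

Lemma roots_locally_bounded K (a : {poly rat}) (F : C -> seq C) : K \is monic ->
  (forall z, ev z a != 0 -> forall x, x \in F z -> root (spec z K) x) ->
  locally_bounded a F.
Proof.
move=> mK h B; have [M M0 hM] := poly_bounded2 K B.
exists (1 + \sum_(i < (size K).-1) M) => z zB az x /(h z az) /monic_root_bound.
rewrite spec_monic // size_spec_monic // => /(_ isT) xb.
rewrite (le_trans xb) // lerD2l ler_sum // => i _.
by rewrite spec_coef hM.
Qed.

(** The coefficients of [P] divided by [q] are, up to sign, elementary symmetric functions of [F z],
    hence bounded; so [q] divides each coefficient of [P]. *)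
Lemma monic_of_locally_bounded (a q : {poly rat}) P (F : C -> seq C) n :
  a != 0 -> q != 0 -> locally_bounded a F ->
  (forall z, ev z a != 0 -> size (F z) = n) ->
  (forall z, ev z a != 0 ->
     spec z P = ev z q *: \prod_(x <- F z) ('X - x%:P)) ->
  exists2 k, k \is monic & forall z, ev z (a * q) != 0 ->
     spec z k = \prod_(x <- F z) ('X - x%:P).
Proof.
move=> a0 q0 bF sF hP.
have dv i : q %| P`_i.
  apply: (@dvdp_of_bounded C _ _ a) => // B; have [M hM] := bF B.
  exists ((1 + `|M|) ^+ n) => z zB az.
  rewrite -spec_coef hP // coefZ normrM mulrC ler_wpM2r // -(sF z az).
  apply: coef_prod_bound => // x /(hM _ zB az) xM.
  by rewrite (le_trans xM) // real_ler_norm // ger0_real // (le_trans _ xM).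
pose k := \poly_(i < n.+1) (P`_i %/ q).
have sz z : ev z a != 0 -> size (\prod_(x <- F z) ('X - x%:P)) = n.+1.
  by move=> az; rewrite size_prod_XsubC sF.
have kz z : ev z (a * q) != 0 -> spec z k = \prod_(x <- F z) ('X - x%:P).
  rewrite rmorphM /= mulf_eq0 negb_or => /andP[az qz].
  apply/polyP => i; rewrite spec_coef coef_poly; case: ltnP => [_|ni]; last first.
    by rewrite rmorph0 nth_default // sz.
  apply: (mulIf qz); rewrite -rmorphM /= divpK // -spec_coef hP // coefZ mulrC.
  by [].
exists k => //.
have aq0 : a * q != 0 by rewrite mulf_neq0.
suff kn : k`_n = 1.
  have sk : size k = n.+1.
    apply/eqP; rewrite eqn_leq size_poly /= ltnNge; apply/negP => h.
    by move/eqP: kn; rewrite nth_default // eq_sym oner_eq0.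
  by apply/monicP; rewrite lead_coefE sk.
apply/eqP; rewrite -subr_eq0; apply/eqP/(ev_eq0 aq0 (C := C)) => z aqz.
rewrite rmorphB rmorph1 /= -spec_coef kz //.
move: aqz; rewrite rmorphM /= mulf_eq0 negb_or => /andP[az _].
apply/eqP; rewrite subr_eq0 -[n]/(n.+1.-1) -(sz z az) -lead_coefE.
exact: (monic_prod_XsubC _ _ _).
Qed.

Lemma separable_prod (p : {poly C}) (r : seq C) : coprimep p p^`() ->
  uniq r -> (root p =i mem r) -> p = lead_coef p *: \prod_(x <- r) ('X - x%:P).
Proof.
move=> cp ur hr.
have p0 : p != 0.
  apply: contraTneq cp => ->; rewrite linear0 coprimep0.
  by rewrite -size_poly_eq1 size_poly0.
suff sp : size p = (size r).+1.
  by apply: all_roots_prod_XsubC => //; [apply/allP => x xr; rewrite [root p x]hr|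
     rewrite uniq_rootsE].
have [rs prs] := closed_field_poly_normal p.
have lc : lead_coef p != 0 by rewrite lead_coef_eq0.
have urs : uniq rs.
  move: cp; rewrite prs derivZ coprimepZl // coprimepZr //.
  by move=> h; rewrite -separable_prod_XsubC; rewrite unlock.
suff : size rs = size r.
  by move=> <-; rewrite prs size_scale // size_prod_XsubC.
apply/perm_size/uniq_perm => // x; rewrite -[RHS]hr -[RHS]/(root p x).
by rewrite prs rootZ // root_prod_XsubC.
Qed.

(** If y were not a root of [k], its full multiplicity in [p] would sit in [g], hence in the
    derivative, where it is one less. With [g] a specialized gcd of a polynomial and its derivative,
    this says that the squarefree part loses no root. *)
Lemma root_dvd_multiplicity (p k g : {poly C}) y (c : C) : p != 0 -> c != 0 ->
  c *: p = k * g -> g %| p^`() -> root p y -> root k y.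
Proof.
move=> p0 c0 pkg gp py; apply/negPn/negP => nk.
have [n [r nz_r Dr]] := multiplicity_XsubC p y.
rewrite p0 /= in nz_r; case: n Dr => [|n] Dr.
  by move: py; rewrite Dr mulr1 (negPf nz_r).
have : ('X - y%:P) ^+ n.+1 %| g.
  rewrite -(@Gauss_dvdpr _ _ k).
    by rewrite -pkg dvdpZr // Dr dvdp_mulIr.
  by rewrite coprimep_expl // coprimep_sym coprimep_XsubC.
move/dvdp_trans/(_ gp); rewrite Dr derivM deriv_exp derivXsubC mul1r.
rewrite dvdp_addr ?dvdp_mulIr // -scaler_nat -!scalerAr dvdpZr ?pnatr_eq0 //.
rewrite exprS dvdp_mul2r ?expf_neq0 ?polyXsubC_eq0 //.
by rewrite dvdp_XsubCl (negPf nz_r).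
Qed.

Lemma rational_family (J : {poly rat}) K (F : C -> seq C) n :
  J != 0 -> K \is monic ->
  (forall z, ev z J != 0 -> uniq (F z)) ->
  (forall z, ev z J != 0 -> size (F z) = n) ->
  (forall z, ev z J != 0 -> root (spec z K) =i mem (F z)) ->
  exists2 k, k \is monic & forall z, ev z J != 0 ->
     spec z k = \prod_(x <- F z) ('X - x%:P).
Proof.
move=> J0 mK uF sF rF.
have K0 : K != 0 by rewrite monic_neq0.
have gK := Pdiv.Idomain.divpK (dvdp_gcdl K K^`()).
set g := gcdp _ _ in gK; set k0 := K %/ g in gK.
set c1 := _ ^+ _ in gK.
have g0 : g != 0 by rewrite gcdp_eq0 (negPf K0).
have c10 : c1 != 0 by rewrite expf_neq0 // lead_coef_eq0.
have k00 : k0 != 0.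
  apply: contraNneq c10 => e; move/eqP: gK; rewrite e mul0r eq_sym scale_poly_eq0.
  by rewrite (negPf K0) orbF.
have /Pdiv.Idomain.dvdpP[[c2 e] /= c20 gK'] := dvdp_gcdr K K^`().
rewrite -/g in gK'.
have := make_separable K0; rewrite unlock -/g -/k0 => /Bezout_coprimepP[[u v] /=].
move=> /eqpP[[c3 c4] /= /andP[c30 c40] bez].
(* [c1] and [c2] are the scalars in the pseudo-divisions of [K] and its derivative by [g], [c4] the
   one in the Bezout relation. Outside the zeros of [a] these relations specialize usefully and [k0]
   keeps its degree. *)
pose a := J * c1 * c2 * c4 * lead_coef k0.
have a0 : a != 0 by rewrite !mulf_neq0 ?lead_coef_eq0.
have agood z : ev z a != 0 -> [/\ ev z J != 0, ev z c1 != 0, ev z c2 != 0,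
   ev z c4 != 0 & ev z (lead_coef k0) != 0].
  by rewrite !rmorphM /= !mulf_eq0 !negb_or -!andbA => /and5P.
have gen z : ev z a != 0 ->
    spec z k0 = ev z (lead_coef k0) *: \prod_(x <- F z) ('X - x%:P).
  move=> /agood[Jz c1z c2z c4z lz].
  rewrite -lead_coef_spec //; apply: separable_prod; last 2 first.
  - exact: uF.
  - have e1 : ev z c1 *: spec z K = spec z k0 * spec z g.
      by rewrite -specZ -gK rmorphM.
    move=> y; rewrite -rF //; apply/idP/idP => [ky|].
      have : root (ev z c1 *: spec z K) y by rewrite e1 /= rootM [root _ y]ky.
      by rewrite rootZ.
    apply: (root_dvd_multiplicity _ c1z e1).
      by rewrite monic_neq0 ?spec_monic.
    rewrite -spec_deriv -(dvdpZr _ _ c2z) -specZ gK' rmorphM.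
    exact: dvdp_mull.
  - rewrite -spec_deriv; apply/Bezout_coprimepP; exists (spec z u, spec z v) => /=.
    rewrite -!rmorphM -rmorphD /=.
    have := congr1 (spec z) bez; rewrite !specZ rmorph1 => e1.
    have h : ev z c4 *: 1 %= (1 : {poly C}) by apply: eqp_scale.
    (* A zero of [c3] would turn the specialized Bezout relation into 0 = c4(z). *)
    have [c3z|c3z] := eqVneq (ev z c3) 0.
      move: e1; rewrite c3z scale0r => /eqP; rewrite eq_sym scale_poly_eq0 oner_eq0.
      by rewrite (negPf c4z).
    by apply: eqp_trans h; rewrite -e1 eqp_sym eqp_scale.
have bF : locally_bounded a F.
  apply: (roots_locally_bounded mK) => z /agood[Jz _ _ _ _] x.
  by move=> xF; rewrite [root _ x]rF.
have q0 : lead_coef k0 != 0 by rewrite lead_coef_eq0.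
have sFa z : ev z a != 0 -> size (F z) = n by case/agood => Jz _ _ _ _; apply: sF.
have [k mk kz] := monic_of_locally_bounded a0 q0 bF sFa gen.
exists k => // z Jz.
have aq0 : a * lead_coef k0 != 0 by rewrite mulf_neq0 ?lead_coef_eq0.
have sk : size k = n.+1.
  have [z' aqz] := @ev_neq0_ex C _ aq0.
  have := congr1 (fun p : {poly C} => size p) (kz _ aqz).
  rewrite size_spec_monic // size_prod_XsubC sF //.
  by move: aqz; rewrite rmorphM mulf_eq0 /= negb_or => /andP[/agood[]].
(* At a non-generic [z], the divisibility of a power of [k] by [K] provides the
   [n] roots in [F z], and [k] has degree [n]. *)
have [Q kQ] : exists Q, k ^+ size K = Q * K.
  apply: (spec_dvd_monic aq0 mK (C := C)) => // z' aqz'; rewrite rmorphXn /= kz //.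
  have [rs prs] := closed_field_poly_normal (spec z' K).
  have lK : lead_coef (spec z' K) = 1 by apply/monicP/spec_monic.
  have srs : (size rs <= size K)%N.
    have := congr1 (fun p : {poly C} => size p) prs.
    rewrite lK scale1r size_prod_XsubC size_spec_monic //.
    by move=> ->.
  have Jz' : ev z' J != 0.
    by move: aqz'; rewrite rmorphM mulf_eq0 /= negb_or => /andP[/agood[]].
  have sub x : x \in rs -> x \in F z'.
    move=> xrs; have := rF _ Jz' x; rewrite [LHS](_ : _ = true) // prs lK scale1r.
    by apply/idP; rewrite -[X in is_true X]/(root _ x) root_prod_XsubC.
  apply: (@dvdp_trans _ ((\prod_(x <- F z') ('X - x%:P)) ^+ size rs)); last exact: dvdp_exp2l.
  rewrite prs lK scale1r; elim: (rs) sub => [|x r IH] sub.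
    by rewrite big_nil dvd1p.
  rewrite big_cons /= exprS dvdp_mul //.
    by rewrite dvdp_XsubCl root_prod_XsubC sub ?mem_head.
  by apply: IH => y yr; rewrite sub // in_cons yr orbT.
have := @all_roots_prod_XsubC _ (spec z k) (F z).
rewrite (monicP (spec_monic z mk)) scale1r; apply.
- by rewrite size_spec_monic // sk sF.
- apply/allP => x xF; have rx : root (spec z K) x by rewrite [root _ x]rF.
  have := congr1 (spec z) kQ; rewrite rmorphXn rmorphM /= => kQz.
  have : root (spec z k ^+ size K) x by rewrite kQz rootM rx orbT.
  by rewrite /root horner_exp expf_eq0 => /andP[].
- by rewrite uniq_rootsE uF.
Qed.

End Families.

(** * Roots of polynomials, norms and denominators *)

Section PowerRoots.

Lemma size_sum_monic (A : nzRingType) (f : nat -> {poly A}) d e :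
  (forall i, (i < e)%N -> f i \is monic) ->
  (forall i, (i < e)%N -> size (f i) = d.+1) ->
  (size (\sum_(i < e) f i)%R <= d.+1)%N /\ (\sum_(i < e) f i)`_d = e%:R.
Proof.
move=> mf sf; split.
  by apply: (leq_trans (size_sum _ _ _)); apply/bigmax_leqP => i _; rewrite sf.
rewrite coef_sum (eq_bigr (fun=> 1)) ?sumr_const ?card_ord // => i _.
by have /monicP := mf i (ltn_ord i); rewrite lead_coefE sf.
Qed.

Lemma size_monic_exp (A : nzRingType) (p : {poly A}) n e :
  p \is monic -> size p = n.+1 -> size (p ^+ e) = (e * n).+1.
Proof.
move=> mp sp; elim: e => [|e IH]; first by rewrite expr0 size_poly1 mul0n.
rewrite exprS size_monicM ?monic_neq0 ?monic_exp //.
by rewrite sp IH mulSn addSn /= addnS.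
Qed.

Lemma sum_powers_monic (A : nzRingType) (p q : {poly A}) n e :
  p \is monic -> size p = n.+1 -> q \is monic -> size q = n.+1 ->
  (size (\sum_(i < e.+1) p ^+ (e - i) * q ^+ i)%R <= (e * n).+1)%N /\
  (\sum_(i < e.+1) p ^+ (e - i) * q ^+ i)`_(e * n) = e.+1%:R.
Proof.
move=> mp sp mq sq.
apply: (size_sum_monic (f := fun i => p ^+ (e - i) * q ^+ i)) => i.
  by rewrite rpredM ?monic_exp.
rewrite ltnS => ie; rewrite size_monicM ?monic_exp ?monic_neq0 ?monic_exp //.
rewrite !(@size_monic_exp _ _ n) // addSn addnS /= -mulnDl subnK //.
Qed.

(* The [n + 1] leading coefficients of [G ^+ e.+1] determine the monic [G] of
   degree [n], as polynomials with rational coefficients; this is what makes the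
   extraction of roots commute with specialization. *)
Lemma monic_root_exists (A : comUnitRingType) (F : {poly A}) n e :
  e.+1%:R \is a @GRing.unit A ->
  F \is monic -> size F = (e.+1 * n).+1 ->
  exists G : {poly A}, [/\ G \is monic, size G = n.+1 &
    (size (F - G ^+ e.+1)%R <= e * n)%N].
Proof.
move=> ue mF sF.
(* The bound says that [F] and [G ^+ e.+1] agree in the leading coefficient and the [k] coefficients
   below it; each round adjusts one more coefficient of [G]. *)
suff h k : (k <= n)%N -> exists G : {poly A}, [/\ G \is monic, size G = n.+1 &
    (size (F - G ^+ e.+1)%R <= e.+1 * n - k)%N].
  by have [G [mG sG hG]] := h n (leqnn n); exists G; split=> //; rewrite mulSn addKn in hG.
elim: k => [_|k IH kn].
  exists 'X^n; rewrite monicXn size_polyXn; split=> //.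
  rewrite subn0; apply/leq_sizeP => j; rewrite leq_eqVlt => /orP[/eqP <-|jn].
    rewrite coefB -exprM [(n * _)%N]mulnC coefXn eqxx -[X in F`_X]/((e.+1 * n).+1.-1).
    by rewrite -sF -lead_coefE (monicP mF) subrr.
  rewrite coefB -exprM coefXn [(n * _)%N]mulnC (gtn_eqF jn) nth_default ?sF // ?subr0 //.
have [G [mG sG hG]] := IH (ltnW kn).
set j := (e.+1 * n - k.+1)%N.
have jE : (e.+1 * n - k)%N = j.+1.
  by rewrite /j subnSK // (leq_trans kn) // leq_pmull.
(* Adding [D] to [G] changes the power by [D * S] (see [E]), where [S] has top coefficient [e.+1] at
   index [e * n]. As [j = (n - k.+1) + e * n], this [c] cancels the coefficient of index [j]. *)
pose c := (F - G ^+ e.+1)`_j / e.+1%:R.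
pose D := c%:P * 'X^(n - k.+1) : {poly A}.
have sD : (size D < n.+1)%N.
  rewrite ltnS (leq_trans (size_polyMleq _ _)) // size_polyXn addnS /=.
  rewrite (leq_trans (leq_add (size_polyC_leq1 _) (leqnn _))) //.
  by rewrite add1n subnSK // leq_subr.
have mG' : G + D \is monic.
  by apply/monicP; rewrite lead_coefDl ?(monicP mG) // sG.
have sG' : size (G + D) = n.+1 by rewrite size_polyDl sG.
exists (G + D); split=> //.
have [sS cS] := sum_powers_monic e mG' sG' mG sG.
have E : F - (G + D) ^+ e.+1 = F - G ^+ e.+1
   - D * (\sum_(i < e.+1) (G + D) ^+ (e - i) * G ^+ i).
  have := subrXX (G + D) G e.+1; rewrite [G + D - G]addrC addrA addNr add0r /= => <-.
  by rewrite opprB addrA subrK.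
move: sS cS E; set S := (\sum_(i < _) _) => sS cS ->.
have DSj i : (D * S)`_i = if (i < n - k.+1)%N then 0 else c * S`_(i - (n - k.+1)).
  rewrite /D mulrAC -mulrA coefCM mulrC [S * _]mulrC coefXnM.
  by case: ifP; rewrite ?mul0r // mulrC.
have jn : (j - (n - k.+1) = e * n)%N.
  by rewrite /j mulSn addnC -addnBA // addnK.
have nj : (n - k.+1 <= j)%N by rewrite /j leq_sub2r // leq_pmull.
apply/leq_sizeP => i; rewrite leq_eqVlt => /orP[/eqP <-|ji].
  by rewrite coefB DSj ltnNge nj /= jn cS /c divrK // subrr.
rewrite coefB DSj nth_default ?jE; last first.
  by rewrite (leq_trans hG) // jE.
case: ifP => _; rewrite ?subrr // nth_default ?mulr0 ?subrr //.
rewrite (leq_trans sS) // -jn ltn_sub2r //; exact: leq_ltn_trans ji.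
Qed.

(** The cofactor of [G - H] in the difference of the powers has the nonzero coefficient [e.+1] at
    index [e * n], so a nonzero [G - H] would make that difference too large. *)
Lemma monic_root_unique (K : fieldType) (G H : {poly K}) n e :
  e.+1%:R != 0 :> K -> G \is monic -> size G = n.+1 -> H \is monic ->
  size H = n.+1 -> (size (G ^+ e.+1 - H ^+ e.+1)%R <= e * n)%N -> G = H.
Proof.
move=> e0 mG sG mH sH; rewrite subrXX /= => h.
apply/eqP; rewrite -subr_eq0; apply/negPn/negP => D0.
have [sS cS] := sum_powers_monic e mG sG mH sH.
set S := (\sum_(i < _) _) in h sS cS.
have S0 : S != 0 by apply: contraNneq e0 => S0; rewrite -cS S0 coef0.
have sS' : (e * n < size S)%N.
  by rewrite ltnNge; apply/negP => /leq_sizeP/(_ _ (leqnn _))/eqP; rewrite cS (negPf e0).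
move: h; rewrite size_mul // leqNgt => /negP; apply.
have := size_poly_gt0 (G - H); rewrite D0; case: (size (G - H)) => // s _ /=.
by rewrite (leq_trans sS') // leq_addl.
Qed.

(** [G] is built from the top coefficients of [F]. Wherever [spec z F] is a power of a monic [g],
    the same coefficients determine [g]; so the identity holds at each such z, generic or not. *)
Lemma power_root_family (C : numClosedFieldType) (F : {poly {poly rat}}) n e :
  F \is monic -> size F = (e.+1 * n).+1 ->
  exists G : {poly {poly rat}}, [/\ G \is monic, size G = n.+1 &
    forall (z : C) g, g \is monic -> size g = n.+1 ->
      spec z F = g ^+ e.+1 -> spec z G = g].
Proof.
move=> mF sF; have ue : e.+1%:R \is a @GRing.unit {poly rat}.
  by rewrite poly_unitE -polyC_natr size_polyC coefC eqxx unitfE pnatr_eq0.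
have [G [mG sG hG]] := monic_root_exists ue mF sF.
exists G; split=> // z g mg sg e1.
apply: (monic_root_unique (n := n) (e := e)); rewrite ?pnatr_eq0 ?spec_monic ?size_spec_monic //.
rewrite -e1 -rmorphXn -rmorphB /= (leq_trans _ hG) //.
by rewrite -(size_polyN (F - _)) opprB size_poly.
Qed.

End PowerRoots.

(** * Norms as determinants *)

Section Norm.
Variable C : numClosedFieldType.

(** Both sides are multiplicative in [q], and for ['X - a%:P] the left one is [char_poly A] at [a]
    up to sign. *)
Lemma det_horner_mx n (A : 'M[C]_n.+1) (r : seq C) (q : {poly C}) :
  char_poly A = \prod_(x <- r) ('X - x%:P) ->
  \det (horner_mx A q) = \prod_(x <- r) q.[x].
Proof.
move=> cA; have sr : size r = n.+1.
  by apply: succn_inj; rewrite -(size_char_poly A) cA size_prod_XsubC.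
have lin a : \det (horner_mx A ('X - a%:P)) = \prod_(x <- r) (x - a).
  rewrite rmorphB /= horner_mx_X horner_mx_C.
  have <- : (-1) ^+ n.+1 * (char_poly A).[a] = \prod_(x <- r) (x - a).
    rewrite cA horner_prod -sr; elim: (r) => [|x s IH].
      by rewrite !big_nil mulr1.
    by rewrite !big_cons -IH exprS hornerXsubC mulrACA mulN1r opprB.
  rewrite -[A - _]opprB -scaleN1r detZ; congr (_ * _).
  rewrite /char_poly -[_.[a]]/(horner_eval a _) -det_map_mx /=.
  congr (\det _); apply/matrixP => i j; rewrite !mxE /horner_eval hornerD hornerN.
  by rewrite hornerC hornerMn hornerX.
have [rs ->] := closed_field_poly_normal q.
set c := lead_coef q; elim: rs => [|y s IH].
  rewrite big_nil -[c *: 1]/(c%:A) alg_polyC horner_mx_C det_scalar -sr.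
  rewrite (eq_bigr (fun=> c)) => [|x _]; last by rewrite hornerC.
  by rewrite big_const_seq count_predT iter_mulr_1.
rewrite big_cons scalerAr rmorphM /= det_mulmx lin {}IH -big_split /=.
by apply: eq_bigr => x _; rewrite hornerM !hornerE.
Qed.

Lemma poly_ext (p q : {poly C}) : (forall x, p.[x] = q.[x]) -> p = q.
Proof.
move=> h; apply/eqP; rewrite -subr_eq0; apply/negPn/negP => d0.
have := max_poly_roots (rs := [seq i%:R : C | i <- iota 0 (size (p - q)%R)]) d0.
rewrite size_map size_iota ltnn => hh; apply: notF; apply: hh.
  by apply/allP => x _; rewrite /root hornerD hornerN h subrr.
by rewrite map_inj_uniq ?iota_uniq // => i j /eqP; rewrite eqr_nat => /eqP.
Qed.

Lemma companion_exists (A : comNzRingType) (h : {poly A}) n :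
  h \is monic -> size h = n.+2 -> exists B : 'M[A]_n.+1, char_poly B = h.
Proof.
move=> mh sh; have := companionmxK mh; move: (companionmx h); rewrite sh.
by move=> B <-; exists B.
Qed.

(** [N] is the resultant of [h] and [U Y - H] in the variable of [h]. As a determinant in a
    companion matrix of [h], it commutes with every specialization, even one that lowers the degrees
    of [U] and [H]. *)
Lemma norm_family (h U H : {poly {poly rat}}) n :
  h \is monic -> size h = n.+2 -> exists N : {poly {poly rat}},
  forall (z : C) r, spec z h = \prod_(x <- r) ('X - x%:P) ->
  spec z N = \prod_(x <- r) ((spec z U).[x] *: 'X - (spec z H).[x]%:P).
Proof.
move=> mh sh; have [B cB] := companion_exists mh sh.
(* Three nested variables: X innermost, then the variable of [N], and outermost the one for which
   the companion matrix is substituted. *)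
pose Q : {poly {poly {poly rat}}} := 'X%:P * U ^:P - H ^:P.
exists (\det (horner_mx (map_mx polyC B) Q)) => z r hr.
apply: poly_ext => w.
pose th := GRing.RMorphism.clone _ _ (horner_eval w \o spec z) _.
have thP (p : {poly {poly rat}}) : map_poly th (p ^:P) = spec z p.
  by rewrite -map_poly_comp; apply: eq_map_poly => c /=; rewrite specC /horner_eval hornerC.
have -> : (spec z (\det (horner_mx (map_mx polyC B) Q))).[w] =
   th (\det (horner_mx (map_mx polyC B) Q)) by [].
rewrite -det_map_mx map_horner_mx -map_mx_comp.
have -> : map_mx (th \o polyC) B = map_mx (ev z) B.
  by apply/matrixP => i j; rewrite !mxE /= specC /horner_eval hornerC.
rewrite (det_horner_mx (r := r)); last by rewrite -map_char_poly cB -hr.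
rewrite horner_prod; apply: eq_bigr => x _.
rewrite /Q rmorphB rmorphM /= !thP map_polyC /= /th /= /spec map_polyX /horner_eval hornerX.
by rewrite !hornerE mulrC.
Qed.

End Norm.

(** * Denominators of rational functions over Q(X) *)

Section Denominators.
Variable C : numClosedFieldType.
Implicit Types (z : C) (b c : {poly rat}) (A B P Q Psi : {poly {poly rat}}).

Lemma root_ev_gcdp z b c : ev z b = 0 -> ev z c = 0 -> ev z (gcdp b c) = 0.
Proof.
move=> bz cz; apply/rootP; rewrite -[root _ _]/(root (map_poly ratr (gcdp b c)) z).
by rewrite gcdp_map root_gcd; apply/andP; split; apply/rootP.
Qed.

(** The common factor of [b] and the coefficients of [A] is divided out until it is constant. A gcd
    over Q[X] vanishes at all common complex zeros, so none is left. *)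
Lemma reduce_content b A : b != 0 -> exists t b1 A1,
  [/\ t != 0, b = t * b1, A = t *: A1 &
      forall z, ev z b1 = 0 -> spec z A1 <> 0].
Proof.
have [n] := ubnP (size b); elim: n => // n IH in b A *; rewrite ltnS => bn b0.
pose d := foldr (@gcdp _) b A.
have db : d %| b.
  by rewrite /d; elim: (A : seq _) => //= a s h; apply: dvdp_trans (dvdp_gcdr _ _) h.
have d0 : d != 0 by apply: contraTneq db => ->; rewrite dvd0p.
have dA i : d %| A`_i.
  rewrite /d; elim: (A : seq _) i => [|a s h] [|i] //=; rewrite ?dvdp0 //.
    exact: dvdp_gcdl.
  exact: dvdp_trans (dvdp_gcdr _ _) (h i).
have dz z : ev z b = 0 -> spec z A = 0 -> ev z d = 0.
  move=> bz Az; have : forall i, ev z A`_i = 0 by move=> i; rewrite -spec_coef Az coef0.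
  rewrite /d; elim: (A : seq _) => //= a s h hi; apply: root_ev_gcdp (hi 0%N) _.
  by apply: h => i; have := hi i.+1.
have [d1|d1] := leqP (size d) 1%N.
  exists 1, b, A; rewrite oner_neq0 mul1r scale1r; split=> // z bz Az.
  have /size_poly1P[c c0 dE] : size d == 1%N by rewrite eqn_leq d1 size_poly_gt0.
  by have /eqP := dz z bz Az; rewrite dE evC fmorph_eq0 (negPf c0).
pose A' := \poly_(i < size A) (A`_i %/ d).
have AE : A = d *: A'.
  apply/polyP => i; rewrite coefZ coef_poly; case: ltnP => iA.
    by rewrite mulrC divpK.
  by rewrite mulr0 nth_default.
have bE : b = d * (b %/ d) by rewrite mulrC divpK.
have b'0 : b %/ d != 0 by apply: contraNneq b0 => e; rewrite bE e mulr0.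
have [|t [b1 [A1 [t0 b1E A1E h]]]] := IH (b %/ d) A' _ b'0.
  rewrite size_divp // (leq_trans _ bn) // ltn_subrL -ltnS prednK ?(ltnW d1) //.
  by rewrite d1 size_poly_gt0.
exists (d * t), b1, A1; rewrite mulf_neq0 //; split=> //.
  by rewrite -mulrA -b1E.
by rewrite -scalerA -A1E.
Qed.

(** The exponent depends on the degree of [p] only, so that one [n] serves all generic
    specializations. *)
Lemma dvd_power_of_roots (p q : {poly C}) n : p != 0 -> (size p <= n)%N ->
  (forall y, root p y -> root q y) -> p %| q ^+ n.
Proof.
move=> p0 pn h; have [rs prs] := closed_field_poly_normal p.
have lc : lead_coef p != 0 by rewrite lead_coef_eq0.
have srs : (size rs <= n)%N.
  by rewrite ltnW // (leq_trans _ pn) // prs size_scale // size_prod_XsubC.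
rewrite prs dvdpZl //; apply: dvdp_trans (dvdp_exp2l q srs).
have sub x : x \in rs -> root q x.
  by move=> xr; apply: h; rewrite prs rootZ // root_prod_XsubC.
elim: (rs) sub => [|x r IH] sub; first by rewrite big_nil dvd1p.
rewrite big_cons /= exprS dvdp_mul //.
  by rewrite dvdp_XsubCl sub ?mem_head.
by apply: IH => y yr; rewrite sub // in_cons yr orbT.
Qed.

(* At a generic [z] the reduced denominator of [A / B] has only roots of [Psi],
   hence over Q(X) it divides a power of [Psi], which leaves a denominator
   [b(X) Psi^n].  If [b] has no common factor with the numerator, then no zero of
   [b] is an admissible [z], because there the fraction has a presentation with
   nonzero denominator. *)
Lemma control_denominator (J : {poly rat}) A B Psi :
  J != 0 -> B != 0 ->
  (forall z, ev z J != 0 -> forall y, exists A' B',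
     [/\ A * B' = A' * B, spec z B' != 0 &
     root (spec z B' %/ gcdp (spec z A') (spec z B')) y ->
       root (spec z Psi) y]) ->
  exists n b A1, forall z, ev z J != 0 -> ev z b != 0 /\
    forall A' B', A * B' = A' * B -> spec z B' != 0 ->
      forall y, ~~ root (spec z Psi) y ->
      ~~ root (spec z B' %/ gcdp (spec z A') (spec z B')) y /\
      (spec z A' %/ gcdp (spec z A') (spec z B')).[y] /
      (spec z B' %/ gcdp (spec z A') (spec z B')).[y] =
      (spec z A1).[y] / (ev z b * (spec z Psi).[y] ^+ n).
Proof.
move=> J0 B0 hyp.
pose g := gcdp A B.
have gn0 : g != 0 by rewrite gcdp_eq0 (negPf B0) andbF.
have lg : lead_coef g != 0 by rewrite lead_coef_eq0.
have := Pdiv.Idomain.divpK (dvdp_gcdl A B); rewrite -/g.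
set A0 := A %/ g; set cA := _ ^+ _ => AE.
have := Pdiv.Idomain.divpK (dvdp_gcdr A B); rewrite -/g.
set B0' := B %/ g; set cB := _ ^+ _ => BE.
have cA0 : cA != 0 by rewrite expf_neq0.
have cB0 : cB != 0 by rewrite expf_neq0.
have B0'0 : B0' != 0.
  apply: contraNneq B0 => e; move/eqP: BE.
  by rewrite e mul0r eq_sym scale_poly_eq0 (negPf cB0).
have cop : coprimep A0 B0'.
  by apply: coprimep_div_gcd; rewrite B0 orbT.
move: cop => /Bezout_coprimepP[[u v] /eqpP[[c3 c4] /= /andP[c30 c40] bez]].
pose n := size B0'.
have [[c1 Q1] /= c10 QE] : exists2 cqq, cqq.1 != 0 & cqq.1 *: Psi ^+ n = cqq.2 * B0'.
  apply/Pdiv.Idomain.dvdpP.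
  pose a := J * cA * cB * c4 * lead_coef B0'.
  have a0 : a != 0 by rewrite !mulf_neq0 ?lead_coef_eq0.
  apply: (spec_dvd a0 (C := C)) => z.
  rewrite !rmorphM /= !mulf_eq0 !negb_or -!andbA => /and5P[Jz cAz cBz c4z lz].
  have B0z : spec z B0' != 0 by rewrite -size_poly_eq0 size_spec // size_poly_eq0.
  rewrite rmorphXn /=; apply: dvd_power_of_roots => //.
    by rewrite size_spec.
  move=> y yB0; have [A' [B' [rel B'z h]]] := hyp z Jz y; apply: h; move: B'z.
  set a' := spec z A'; set b' := spec z B' => b'0; set d := gcdp a' b'.
  have dn0 : d != 0 by rewrite gcdp_eq0 (negPf b'0) andbF.
  have a'E : a' %/ d * d = a' by rewrite divpK ?dvdp_gcdl.
  have b'E : b' %/ d * d = b' by rewrite divpK ?dvdp_gcdr.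
  have e1 : cB *: (A0 * B') = cA *: (A' * B0').
    apply: (mulIf gn0).
    have -> : cB *: (A0 * B') * g = cB *: ((A0 * g) * B').
      by rewrite -scalerAl mulrAC.
    have -> : cA *: (A' * B0') * g = cA *: (A' * (B0' * g)).
      by rewrite -scalerAl mulrA.
    by rewrite AE BE -scalerAl -scalerAr rel !scalerA mulrC.
  have e2 : ev z cB *: (spec z A0 * b') = ev z cA *: (a' * spec z B0').
    by have := congr1 (spec z) e1; rewrite !specZ !rmorphM.
  have e3 : ev z cB *: (spec z A0 * (b' %/ d)) = ev z cA *: ((a' %/ d) * spec z B0').
    apply: (mulIf dn0); rewrite -!scalerAl -mulrA b'E.
    by rewrite [_ * spec z B0' * d]mulrAC a'E.
  (* The Bezout relation keeps [A0] from vanishing at a root y of [B0']; by [e3], y is then a root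
     of the reduced denominator. *)
  have A0y : (spec z A0).[y] != 0.
    apply/eqP => A0y; have := congr1 (fun p => (spec z p).[y]) bez => /=.
    rewrite !specZ rmorphD !rmorphM rmorph1 /= !hornerE A0y (rootP yB0).
    rewrite !mulr0 addr0 mulr0.
    by move/eqP; rewrite eq_sym (negPf c4z).
  have := congr1 (fun p : {poly C} => p.[y]) e3; rewrite /= !hornerZ !hornerM (rootP yB0) !mulr0.
  by move/eqP; rewrite !mulf_eq0 (negPf cBz) (negPf A0y).
have [t [b [A1 [t0 bE A1E h]]]] := reduce_content (cB *: (A0 * Q1)) (mulf_neq0 cA0 c10).
have rel0 : A * (b *: Psi ^+ n) = A1 * B.
  have h0 : (t * cB)%:P != 0 by rewrite polyC_eq0 mulf_neq0.
  apply: (mulfI h0).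
  have -> : (t * cB)%:P * (A * (b *: Psi ^+ n)) = cB *: ((cA *: A) * (c1 *: Psi ^+ n)).
    rewrite mul_polyC -!scalerAr -!scalerAl !scalerA; congr (_ *: _).
    by rewrite mulrAC -bE [RHS]mulrC -mulrA [c1 * _]mulrC.
  have -> : (t * cB)%:P * (A1 * B) = (t *: A1) * (cB *: B).
    by rewrite mul_polyC -scalerAr -scalerAl scalerA mulrC.
  rewrite -A1E -AE -BE QE -!scalerAl; congr (_ *: _).
  by rewrite -!mulrA; congr (_ * _); rewrite mulrC -mulrA.
have rel1 A' B' : A * B' = A' * B -> A' * (b *: Psi ^+ n) = A1 * B'.
  move=> rel; apply: (mulIf B0); rewrite mulrAC -rel mulrAC rel0.
  by rewrite mulrAC.
exists n, b, A1 => z Jz.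
have bz : ev z b != 0.
  (* Any point would do in place of 0: what matters is a presentation whose denominator survives at
     z. If [b] vanished there, [rel1] would make [spec z A1] zero as well. *)
  have [A' [B' [rel B'z _]]] := hyp z Jz 0.
  apply/eqP => bz; apply: (h z bz); have := congr1 (spec z) (rel1 _ _ rel).
  rewrite !rmorphM /= specZ bz scale0r mulr0 => /esym/eqP.
  by rewrite mulf_eq0 (negPf B'z) orbF => /eqP.
split=> // A' B' rel B'z y Py.
have := congr1 (spec z) (rel1 _ _ rel); rewrite !rmorphM /= specZ rmorphXn /=.
move: B'z; set a' := spec z A'; set b' := spec z B' => b'0; set d := gcdp a' b'.
have dn0 : d != 0 by rewrite gcdp_eq0 (negPf b'0) andbF.
have a'E : a' %/ d * d = a' by rewrite divpK ?dvdp_gcdl.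
have b'E : b' %/ d * d = b' by rewrite divpK ?dvdp_gcdr.
have cop : coprimep (a' %/ d) (b' %/ d).
  by apply: coprimep_div_gcd; rewrite b'0 orbT.
rewrite -{1}a'E -{1}b'E mulrAC mulrA => /(mulIf dn0).
move/(congr1 (fun p : {poly C} => p.[y])); rewrite /= !hornerM hornerZ.
rewrite horner_exp => e.
have den0 : ev z b * (spec z Psi).[y] ^+ n != 0.
  by rewrite mulf_neq0 ?expf_neq0.
have nr : ~~ root (b' %/ d) y.
  apply/negP => ry; have ra : root (a' %/ d) y.
    rewrite /root; move/eqP: e; rewrite (rootP ry) mulr0 mulf_eq0.
    by rewrite (negPf den0) orbF.
  have := coprimep_root cop ra; by rewrite (rootP ry) eqxx.
split=> //; apply/eqP; rewrite eqr_div // e.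
by rewrite mulrC.
Qed.

End Denominators.

(** * Counting cyclic subgroups *)

Section JordanTotient.
Local Open Scope nat_scope.

(** Jordan's totient J_2: the number of elements of exact order [n] in (Z/n)^2. *)
Definition jordan2 n := \sum_(0 <= a < n) \sum_(0 <= b < n) coprime (gcdn a b) n.

Lemma sum_mod_period (f : nat -> nat) p n :
  \sum_(0 <= a < p * n) f (a %% n) = p * \sum_(0 <= a < n) f a.
Proof.
elim: p => [|p IH]; first by rewrite !mul0n big_geq.
rewrite mulSn addnC (big_cat_nat _ (n := p * n)) ?leq_addr //= IH mulSn addnC.
congr (_ + _); rewrite -{1}[p * n]add0n big_addn addKn.
by apply: eq_big_nat => i /andP[_ ilt]; rewrite addnC modnMDl modn_small.
Qed.

Lemma sum_multiples (f : nat -> nat) p n : 0 < p ->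
  \sum_(0 <= a < p * n | p %| a) f a = \sum_(0 <= a < n) f (p * a).
Proof.
move=> p0; elim: n => [|n IH]; first by rewrite muln0 !big_geq.
rewrite mulnS addnC (big_cat_nat _ (n := p * n)) ?leq_addr //= IH big_nat_recr //=.
congr (_ + _); rewrite -{1}[p * n]add0n big_addn addKn.
rewrite big_mkcond /= -(prednK p0) big_nat_recl //= prednK //.
rewrite add0n dvdn_mulr // big_nat big1 ?addn0 // => i /andP[_ ip].
rewrite dvdn_addl ?dvdn_mulr // gtnNdvd //.
by rewrite -(prednK p0) ltnS.
Qed.

Lemma coprime_gcdn_mod a b n :
  coprime (gcdn (a %% n) (b %% n)) n = coprime (gcdn a b) n.
Proof.
rewrite /coprime; congr (_ == _).
by rewrite -gcdnA gcdn_modl gcdnCA gcdn_modl gcdnCA gcdnA.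
Qed.

Lemma sum_coprime_period p n :
  \sum_(0 <= a < p * n) \sum_(0 <= b < p * n) coprime (gcdn a b) n =
  p ^ 2 * jordan2 n.
Proof.
rewrite /jordan2 expnS expn1 -mulnA big_distrr /=.
rewrite -(sum_mod_period (fun a => p * \sum_(0 <= b < n) coprime (gcdn a b) n)).
apply: eq_bigr => a _.
rewrite -(sum_mod_period (fun b => coprime (gcdn (a %% n) b) n : nat)).
by apply: eq_bigr => b _; rewrite coprime_gcdn_mod.
Qed.

Lemma jordan2_dvd p n : prime p -> p %| n -> jordan2 (p * n) = p ^ 2 * jordan2 n.
Proof.
move=> pp pn; rewrite -sum_coprime_period; apply: eq_bigr => a _; apply: eq_bigr => b _.
rewrite coprimeMr; case: (boolP (coprime _ n)); rewrite ?andbF // andbT => h.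
by rewrite (coprime_dvdr pn h).
Qed.

(** Among the pairs below [p * n] with gcd prime to [n], those with gcd prime to [p] are counted by
    [jordan2 (p * n)]; the others are [p] times the pairs counted by [jordan2 n]. *)
Lemma jordan2_ndvd p n : prime p -> ~~ (p %| n) ->
  jordan2 (p * n) + jordan2 n = p ^ 2 * jordan2 n.
Proof.
move=> pp pn; rewrite -sum_coprime_period.
have p0 := prime_gt0 pp.
have copn : coprime p n by rewrite prime_coprime.
have -> : jordan2 n = \sum_(0 <= a < p * n) \sum_(0 <= b < p * n)
    (coprime (gcdn a b) n && (p %| gcdn a b)).
  rewrite /jordan2 [RHS](bigID (fun a => p %| a)) /= [X in _ + X]big1 ?addn0.
    rewrite (sum_multiples (fun a => \sum_(0 <= b < p * n)
      (coprime (gcdn a b) n && (p %| gcdn a b)))) //.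
    apply: eq_bigr => a _; rewrite [RHS](bigID (fun b => p %| b)) /= [X in _ + X]big1 ?addn0.
      rewrite (sum_multiples (fun b =>
        coprime (gcdn (p * a) b) n && (p %| gcdn (p * a) b) : nat)) //.
      by apply: eq_bigr => b _; rewrite -muln_gcdr dvdn_mulr // andbT coprimeMl copn.
    by move=> b pb; rewrite dvdn_gcd (negPf pb) !andbF.
  by move=> a pa; rewrite big1 // => b _; rewrite dvdn_gcd (negPf pa) !andbF.
rewrite /jordan2 -big_split; apply: eq_bigr => a _; rewrite -big_split.
apply: eq_bigr => b _ /=; rewrite coprimeMr coprime_sym prime_coprime //.
by case: (coprime _ n); case: (p %| _).
Qed.
End JordanTotient.

Lemma totient_prod_rat n : (0 < n)%N ->
  (totient n)%:R = n%:R * \prod_(p <- primes n) (1 - p%:R^-1) :> rat.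
Proof.
move=> n0; rewrite totientE // [X in _ = X%:R * _]prod_prime_decomp // prime_decompE big_map /=.
rewrite !natr_prod -big_split /= !big_seq; apply: eq_bigr => p.
rewrite mem_primes => /and3P[pp _ pn].
have p0 : p%:R != 0 :> rat by rewrite pnatr_eq0 -lt0n prime_gt0.
have l0 : (0 < logn p n)%N by rewrite logn_gt0 mem_primes pp n0.
have pE : p.-1%:R = p%:R - 1 :> rat.
  by rewrite -[X in _ = X%:R - 1](prednK (prime_gt0 pp)) -natr1 addrK.
rewrite -[X in _ = (p ^ X)%:R * _](prednK l0) natrM !natrX exprS pE.
by field.
Qed.

(** One prime factor is removed at a time; the product over primes changes only when the last
    occurrence of a prime goes. *)
Lemma jordan2_prod n : (0 < n)%N ->
  (jordan2 n)%:R = n%:R ^+ 2 * \prod_(p <- primes n) (1 - p%:R^-2) :> rat.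
Proof.
have [k] := ubnP n; elim: k => // k IH in n *; rewrite ltnS => nk n0.
have [n1|n1] := leqP n 1%N.
  have -> : n = 1%N by apply/eqP; rewrite eqn_leq n1 n0.
  by rewrite /jordan2 !big_nat1 big_nil.
have pp := pdiv_prime n1; set p := pdiv n in pp.
have pn : (p %| n)%N := pdiv_dvd n; pose n' := (n %/ p)%N.
have nE : n = (p * n')%N by rewrite mulnC divnK.
have n'0 : (0 < n')%N by move: n0; rewrite nE muln_gt0 => /andP[].
have n'n : (n' < n)%N by rewrite nE ltn_Pmull // prime_gt1.
have p0 : p%:R != 0 :> rat by rewrite pnatr_eq0 -lt0n prime_gt0.
have e := IH n' (leq_trans n'n nk) n'0.
have mp x : (x \in primes n) = (x == p) || (x \in primes n').
  by rewrite nE (primesM _ (prime_gt0 pp) n'0) (primes_prime pp) inE.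
have [pn'|pn'] := boolP (p %| n')%N.
  have -> : primes n = primes n'.
    apply: (irr_sorted_eq ltn_trans ltnn) (sorted_primes _) (sorted_primes _) _ => x.
    by rewrite mp; case: eqP => //= ->; rewrite mem_primes pp n'0 pn'.
  by rewrite nE jordan2_dvd // natrM e natrM natrX exprMn mulrA.
have -> : \prod_(q <- primes n) (1 - q%:R^-2) =
    (1 - p%:R^-2) * \prod_(q <- primes n') (1 - q%:R^-2) :> rat.
  rewrite -(big_cons _ _ p (primes n') xpredT); apply: perm_big; apply: uniq_perm.
  - exact: primes_uniq.
  - by rewrite /= primes_uniq andbT mem_primes pp n'0 (negPf pn').
  - by move=> x; rewrite mp inE.
have := jordan2_ndvd pp pn'; rewrite -nE => /(congr1 (fun k => k%:R : rat)).
rewrite /= natrD natrM natrX e => /(canRL (addrK _)) ->.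
rewrite [in RHS]nE natrM exprMn [RHS]mulrACA [n'%:R ^+ 2 * _]mulrC mulrA.
by field.
Qed.

(** Since 1 - p^-2 = (1 - p^-1)(1 + p^-1), the quotient of J_2 by the totient is [psi n]; this will
    be the number of cyclic subgroups of order [n]. *)
Lemma jordan2_totient n : (0 < n)%N ->
  (jordan2 n)%:R = (totient n)%:R * (n%:R * \prod_(p <- primes n) (1 + p%:R^-1)) :> rat.
Proof.
move=> n0; rewrite totient_prod_rat // mulrACA -expr2 -big_split jordan2_prod //.
congr (_ * _); apply: eq_bigr => p _ /=.
by rewrite -subr_sqr expr1n exprVn.
Qed.

(** * Elements of order m and the cyclic subgroups they generate *)

Section OrderSet.
Variables (V : finZmodType) (m : nat).
Hypothesis m_gt0 : (0 < m)%N.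
Implicit Types (i j : V) (A : {set V}).

Definition order_set : {set V} :=
  [set i | (i *+ m == 0) && [forall k : 'I_m, (i *+ k == 0) ==> (k == 0 :> nat)]].

Lemma order_setP i : reflect (forall k, i *+ k = 0 <-> (m %| k)%N) (i \in order_set).
Proof.
apply: (iffP idP); rewrite inE.
  case/andP => /eqP im /forallP h k; split=> [ik|/dvdnP[l ->]]; last first.
    by rewrite mulnC mulrnA im mul0rn.
  have := h (Ordinal (ltn_pmod k m_gt0)); rewrite /= => /implyP; apply.
  by move/eqP: ik; rewrite {1}(divn_eq k m) mulrnDr mulnC mulrnA im mul0rn add0r.
move=> h; apply/andP; split; first by apply/eqP/h.
apply/forallP => k; apply/implyP => /eqP/h/dvdnP[[|l] e]; first by rewrite e.
by have := ltn_ord k; rewrite e mulSn ltnNge leq_addr.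
Qed.

Lemma order_set_inj i k l : i \in order_set -> (k < m)%N -> (l < m)%N ->
  i *+ k = i *+ l -> k = l.
Proof.
move=> /order_setP h; wlog kl : k l / (k <= l)%N => [hw|] km lm e.
  case/orP: (leq_total k l) => hkl; first exact: (hw k l).
  by apply/esym; apply: (hw l k).
have /h/dvdnP[[|r]] : i *+ (l - k) = 0 by rewrite mulrnBr // e subrr.
  by move/eqP; rewrite mul0n subn_eq0 => lk; apply/eqP; rewrite eqn_leq kl.
by rewrite mulSn; lia.
Qed.

Lemma order_set_mul i k : i \in order_set -> coprime k m -> i *+ k \in order_set.
Proof.
move=> /order_setP h km; apply/order_setP => l; rewrite -mulrnA h.
by rewrite Gauss_dvdr // coprime_sym.
Qed.

(** For [i] of order [m], the generators of the subgroup spanned by [i]. *)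
Definition cyclic_block i : {set V} := [set i *+ (k : nat) | k : 'I_m & coprime k m].

Lemma mem_cyclic_block i k : i *+ m = 0 -> coprime k m -> i *+ k \in cyclic_block i.
Proof.
move=> im km; apply/imsetP; exists (Ordinal (ltn_pmod k m_gt0)).
  by rewrite inE /= coprime_modl.
by rewrite /= {1}(divn_eq k m) mulrnDr mulnC mulrnA im mul0rn add0r.
Qed.

Lemma card_cyclic_block i : i \in order_set -> #|cyclic_block i| = totient m.
Proof.
move=> io; rewrite card_in_imset => [|k l _ _ /(order_set_inj io (ltn_ord k) (ltn_ord l))].
  rewrite totient_count_coprime big_mkord -sum1_card big_mkcond /=.
  by apply: eq_bigr => k _; rewrite inE coprime_sym; case: coprime.
exact: val_inj.
Qed.

Lemma cyclic_block_sym i k : i *+ m = 0 -> coprime k m ->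
  exists2 l, coprime l m & i *+ k *+ l = i.
Proof.
move=> im km.
have m1 : (m - (m - 1) = 1)%N by lia.
have [k0|k0] := posnP k.
  have m1' : m = 1%N by move: km; rewrite k0 /coprime gcd0n => /eqP.
  exists 1%N; first by rewrite m1'.
  by rewrite k0 mulr0n mul0rn; move: im; rewrite m1'.
have [u v e _] := egcdnP m k0.
have g1 : gcdn k m = 1%N by apply/eqP.
rewrite g1 in e; exists u.
  have : coprime (u * k) m by rewrite e /coprime gcdnC gcdnMDl gcdn1.
  by rewrite coprimeMl => /andP[].
by rewrite -mulrnA mulnC e mulrnDr mulr1n mulnC mulrnA im mul0rn add0r.
Qed.

(** [s] picks one generator in each cyclic subgroup of order [m]. Removing the generators of one
    subgroup leaves a set stable under multiplication by units modulo [m], so the induction runs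
    over such stable sets. *)
Lemma cyclic_representatives (R : comNzRingType) :
  exists s : seq V, [/\ {subset s <= order_set},
    forall i, i \in order_set -> exists2 j, j \in s &
      exists2 k, coprime k m & i = j *+ k,
    (size s * totient m = #|order_set|)%N &
    forall f : V -> R,
      (forall i k, i \in order_set -> coprime k m -> f (i *+ k) = f i) ->
      \prod_(i in order_set) f i = (\prod_(i <- s) f i) ^+ totient m].
Proof.
suff h (A : {set V}) : A \subset order_set ->
  (forall i k, i \in A -> coprime k m -> i *+ k \in A) ->
  exists s : seq V, [/\ {subset s <= A},
    forall i, i \in A -> exists2 j, j \in s & exists2 k, coprime k m & i = j *+ k,
    (size s * totient m = #|A|)%N &
    forall f : V -> R,
      (forall i k, i \in order_set -> coprime k m -> f (i *+ k) = f i) ->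
      \prod_(i in A) f i = (\prod_(i <- s) f i) ^+ totient m].
  by apply: h => // i k; apply: order_set_mul.
have [n] := ubnP #|A|; elim: n => // n IH in A *; rewrite ltnS => An Ao cl.
have [->|[i iA]] := set_0Vmem A.
  exists [::]; split=> // [i||f _]; rewrite ?inE ?cards0 //.
  by rewrite big_set0 big_nil expr1n.
have io := subsetP Ao _ iA.
have im : i *+ m = 0 by apply/(order_setP _ io).
have BA : cyclic_block i \subset A.
  by apply/subsetP => x /imsetP[k]; rewrite inE => km ->; apply: cl.
have [|||s [s1 s2 s3 s4]] := IH (A :\: cyclic_block i).
- rewrite (leq_trans _ An) // (cardsD1 i A) iA add1n ltnS subset_leq_card //.
  apply/subsetP => j; rewrite !inE => /andP[jB ->]; rewrite andbT.
  apply: contraNneq jB => ->; rewrite -[X in X \in _]mulr1n.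
  by apply: mem_cyclic_block => //; rewrite coprime1n.
- exact: subset_trans (subsetDl _ _) Ao.
- move=> j k; rewrite !in_setD => /andP[jB jA] km; rewrite cl // andbT.
  apply: contra jB => /imsetP[l]; rewrite inE => lm e.
  have jm : j *+ m = 0 by apply/(order_setP _ (subsetP Ao _ jA)).
  have [l' l'm e'] := cyclic_block_sym jm km.
  by rewrite -e' e -mulrnA; apply: mem_cyclic_block => //; rewrite coprimeMl lm.
exists (i :: s); split.
- move=> j; rewrite inE => /orP[/eqP -> //|/s1]; by rewrite in_setD => /andP[].
- move=> j jA; case: (boolP (j \in cyclic_block i)) => [/imsetP[k]|jB].
    by rewrite inE => km ->; exists i; rewrite ?mem_head //; exists (k : nat).
  have [|j' j's h] := s2 j; first by rewrite in_setD jB.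
  by exists j' => //; rewrite inE j's orbT.
- by rewrite /= mulSn s3 -(card_cyclic_block io) cardsD (setIidPr BA) subnKC // subset_leq_card.
move=> f hf; rewrite big_cons exprMn -s4 // (big_setID (cyclic_block i)) /= (setIidPr BA).
congr (_ * _); rewrite -(card_cyclic_block io) -prodr_const; apply: eq_bigr => j /imsetP[k].
by rewrite inE => km ->; rewrite hf.
Qed.

(** [i = - i] means [i *+ 2 = 0], which for order [m] > 1 happens only if [m] is 2. This is the
    origin of the exponent [(m != 2).+1]: 1 if [m] is 2, otherwise 2. *)
Lemma order_set_opp i : (1 < m)%N -> i \in order_set ->
  #|[set j in order_set | (j == i) || (j == - i)]| = (m != 2).+1.
Proof.
move=> m1 io; have -> : [set j in order_set | (j == i) || (j == - i)] = [set i; - i].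
  apply/setP => j; rewrite in_set in_set2; apply: andb_idl => /orP[] /eqP -> //.
  have /order_setP h := io.
  apply/order_setP => k; rewrite mulNrn -h.
  by split=> [/eqP|->]; rewrite ?oppr0 ?oppr_eq0 // => /eqP.
rewrite cards2; congr (nat_of_bool _).+1.
rewrite -addr_eq0 -mulr2n; have /order_setP h := io.
apply: negbLR; rewrite negbK; apply/eqP/eqP => [/h m2|m2].
  by apply/eqP; rewrite eqn_leq dvdn_leq.
by apply/h; rewrite m2.
Qed.

Lemma prod_order_set (R : comNzRingType) (T : eqType) (x : V -> T) (g : T -> R) :
  (1 < m)%N ->
  (forall i j, i \in order_set -> j \in order_set -> x i = x j <-> i = j \/ i = - j) ->
  \prod_(i in order_set) g (x i) =
  (\prod_(y <- undup [seq x i | i <- enum order_set]) g y) ^+ (m != 2).+1.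
Proof.
move=> m1 hx; rewrite -big_enum -(big_map x xpredT) /=.
rewrite -big_undup_iterop_count -prodrXl !big_seq; apply: eq_bigr => y.
rewrite mem_undup => /mapP[ i]; rewrite mem_enum => io ->.
rewrite -[RHS]/(iterop _ _ _ _); congr (iterop _ _ _ _).
rewrite -(order_set_opp m1 io) count_map cardE -size_filter; congr size.
have -> : enum [set j in order_set | (j == i) || (j == - i)] =
   [seq j <- enum order_set | (j == i) || (j == - i)].
  rewrite /enum_mem -filter_predI; apply: eq_filter => j.
  by rewrite /= !inE andbC.
apply: eq_in_filter => j; rewrite mem_enum /= => jo.
apply/eqP/orP => [/(hx _ _ jo io)[->|->]|h]; rewrite ?eqxx; auto.
by apply/(hx _ _ jo io); case: h => /eqP; auto.
Qed.

End OrderSet.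

(** (Z/m)^2 for [m = q.+2]. As m > 1, the elements of exact order m are nonzero, so that their
    x-coordinates will be finite; m = 1 is treated apart. *)
Definition pairs q := ('I_q.+2 * 'I_q.+2)%type.
HB.instance Definition _ q := Finite.on (pairs q).
HB.instance Definition _ q := GRing.Zmodule.on (pairs q).

Lemma card_order_set_pairs q : #|order_set (pairs q) q.+2| = jordan2 q.+2.
Proof.
set m := q.+2; pose V := pairs q.
have memE (i : V) : (i \in order_set V m) = coprime (gcdn i.1 i.2) m.
  have mulE k : i *+ k = 0 <-> (m %| gcdn i.1 i.2 * k)%N.
    have h (a : 'I_m) : a *+ k = 0 <-> (m %| a * k)%N.
      rewrite /dvdn; split=> [/(congr1 val)|/eqP e]; rewrite Zp_mulrn.
        by move=> /= ->.
      by apply: val_inj.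
    have hp : i *+ k = (i.1 *+ k, i.2 *+ k).
      by rewrite [LHS]surjective_pairing; congr pair; [exact: (raddfMn fst)|exact: (raddfMn snd)].
    rewrite hp muln_gcdl dvdn_gcd; split=> [[/h -> /h ->] //|/andP[/h -> /h ->] //].
  apply/order_setP/idP => // [h|co k]; last first.
    rewrite mulE Gauss_dvdr // coprime_sym //.
  (* With g the gcd of both coordinates and [m], the multiple by [m %/ g] is already 0; so [m]
     divides [m %/ g] and g = 1. *)
  rewrite /coprime; set g := gcdn _ m; have gm : (g %| m)%N by apply: dvdn_gcdr.
  have : (m %| m %/ g)%N.
    by apply/h/mulE; rewrite -{1}(divnK gm) mulnC dvdn_mul // dvdn_gcdl.
  have g0 : (0 < g)%N by rewrite gcdn_gt0 orbT.
  have d0 : (0 < m %/ g)%N by rewrite divn_gt0 // dvdn_leq.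
  move=> /(dvdn_leq d0); rewrite leq_divRL // => mg; rewrite eqn_leq g0 andbT.
  by rewrite -(leq_pmul2l (ltn0Sn q.+1)) muln1.
transitivity (\sum_(p : 'I_m * 'I_m) coprime (gcdn p.1 p.2) m)%N.
  rewrite -sum1_card big_mkcond /=; apply: eq_bigr => p _.
  by rewrite memE; case: coprime.
rewrite /jordan2 big_mkord -(pair_bigA _ (fun a b : 'I_m => coprime (gcdn a b) m : nat)) /=.
by apply: eq_bigr => a _; rewrite big_mkord.
Qed.

(** * Complex tori and their isogenies *)

From mathcomp Require Import generic_quotient ring_quotient fraction.
From mathcomp Require Import boolp classical_sets functions cardinality.
From mathcomp Require Import topology normedtype derive trigo complex.
From mathcomp Require mpoly.

Import Order.TTheory GRing.Theory Num.Theory numFieldNormedType.Exports.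

Local Open Scope classical_set_scope.
Local Open Scope ring_scope.

Section Torus.
Variables (R : realType) (E : lattice R).
Implicit Types (P Q : curve E) (a b c d : int) (z w : R[i]).

Lemma torus_projB z w : torus_proj E (z - w) = torus_proj E z - torus_proj E w.
Proof. exact: (pi_is_zmod_morphism (Quotient.quot (lattice_pred E)) z w). Qed.

HB.instance Definition _ :=
  GRing.isZmodMorphism.Build R[i] (curve E) (torus_proj E) torus_projB.

Lemma torus_proj0 : torus_proj E 0 = 0. Proof. exact: raddf0. Qed.

Lemma torus_projD z w : torus_proj E (z + w) = torus_proj E z + torus_proj E w.
Proof. exact: raddfD. Qed.

Lemma torus_projMn z n : torus_proj E (z *+ n) = torus_proj E z *+ n.
Proof. exact: raddfMn. Qed.

Lemma torus_projMz z a : torus_proj E (z *~ a) = torus_proj E z *~ a.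
Proof. exact: raddfMz. Qed.

Lemma torus_proj_eq0 z : torus_proj E z = 0 <->
  exists a b, z = a%:~R * w1 E + b%:~R * w2 E.
Proof.
rewrite -torus_proj0 /torus_proj; split=> [/eqP|h].
  by rewrite -Quotient.idealrBE subr0 => /asboolP.
by apply/eqP; rewrite -Quotient.idealrBE subr0; apply/asboolP.
Qed.

Lemma torus_proj_surj P : exists z, P = torus_proj E z.
Proof. by exists (repr P); rewrite /torus_proj reprK. Qed.

Lemma w2_neq0 : w2 E != 0.
Proof.
apply/eqP => e; have := lattice_oriented E.
by rewrite e invr0 mulr0 ltxx.
Qed.

Lemma w1E : w1 E = w1 E / w2 E * w2 E.
Proof. by rewrite divfK // w2_neq0. Qed.

Lemma intC a : a%:~R = (a%:~R +i* 0)%C :> R[i].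
Proof. by rewrite -[RHS]/((a%:~R : R)%:C)%C rmorph_int. Qed.

Lemma lattice_free a b : a%:~R * w1 E + b%:~R * w2 E = 0 -> a = 0 /\ b = 0.
Proof.
rewrite w1E mulrA -mulrDl => /eqP; rewrite mulf_eq0 (negPf w2_neq0) orbF.
have := lattice_oriented E; case: (w1 E / w2 E) => x y /= y0.
rewrite !intC eq_complex /= !(mul0r, mulr0, subr0, addr0, add0r).
case/andP => h1; rewrite mulf_eq0 (gt_eqF y0) orbF intr_eq0 => /eqP a0.
by move: h1; rewrite a0 mul0r add0r intr_eq0 => /eqP.
Qed.

Definition division_point (n : nat) a b : curve E :=
  torus_proj E ((a%:~R * w1 E + b%:~R * w2 E) / n%:R).

Lemma division_pointD n a b c d :
  division_point n (a + c) (b + d) = division_point n a b + division_point n c d.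
Proof. by rewrite /division_point -torus_projD !rmorphD /=; congr torus_proj; ring. Qed.

Lemma division_pointMz n a b c :
  division_point n a b *~ c = division_point n (a * c) (b * c).
Proof.
rewrite /division_point -torus_projMz !rmorphM /= -mulrzr; congr torus_proj; ring.
Qed.

Lemma division_pointMn n a b k :
  division_point n a b *+ k = division_point n (a * k%:Z) (b * k%:Z).
Proof. by rewrite -division_pointMz. Qed.

Lemma division_pointN n a b : - division_point n a b = division_point n (- a) (- b).
Proof. by rewrite -[LHS]mulrN1z division_pointMz !mulrN1. Qed.

Lemma division_point_eq0 n a b : (0 < n)%N ->
  division_point n a b = 0 <-> (n %| a)%Z /\ (n %| b)%Z.
Proof.
move=> n0; have nn : n%:R != 0 :> R[i] by rewrite pnatr_eq0 -lt0n.
rewrite /division_point torus_proj_eq0; split.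
  case=> c [d] /(canRL (divfK nn)) e.
  have e1 : (a - c * n%:Z)%:~R * w1 E + (b - d * n%:Z)%:~R * w2 E = 0.
    rewrite !rmorphB !rmorphM /= -[n%:~R]/(n%:R) !mulrBl.
    rewrite addrACA -opprD e; ring.
  have [/eqP + /eqP] := lattice_free e1.
  by rewrite !subr_eq0 => /eqP -> /eqP ->; rewrite !dvdz_mull.
case=> /dvdzP[c ->] /dvdzP[d ->]; exists c, d.
by rewrite !rmorphM /= -[n%:~R]/(n%:R); field.
Qed.

Lemma torsion_division_point n P : (0 < n)%N -> P *+ n = 0 ->
  exists a b, P = division_point n a b.
Proof.
move=> n0; have nn : n%:R != 0 :> R[i] by rewrite pnatr_eq0 -lt0n.
have [z ->] := torus_proj_surj P; rewrite -torus_projMn => /torus_proj_eq0[a [b e]].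
by exists a, b; rewrite /division_point -e -(mulr_natr z n) mulfK.
Qed.

Lemma division_point_torsion n a b : (0 < n)%N -> division_point n a b *+ n = 0.
Proof.
move=> n0; rewrite division_pointMn; apply/division_point_eq0 => //.
by split; apply: dvdz_mull.
Qed.

Lemma has_orderP P n : (0 < n)%N -> P *+ n = 0 ->
  (forall k : nat, (0 < k < n)%N -> P *+ k != 0) -> has_order P n.
Proof.
move=> n0 Pn h; split=> // k; split=> [Pk|/dvdnP[l ->]]; last first.
  by rewrite mulnC mulrnA Pn mul0rn.
rewrite /dvdn; apply/negPn/negP => k0.
have := h (k %% n)%N; rewrite lt0n k0 ltn_pmod // => /(_ isT)/negP; apply.
by apply/eqP; move: Pk; rewrite {1}(divn_eq k n) mulrnDr mulnC mulrnA Pn mul0rn add0r.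
Qed.

Lemma has_order_exists P n : (0 < n)%N -> P *+ n = 0 ->
  exists2 k, has_order P k & (k %| n)%N.
Proof.
move=> n0 Pn; have ex : exists k, (0 < k)%N && (P *+ k == 0).
  by exists n; rewrite n0 Pn eqxx.
case: (ex_minnP ex) => k /andP[k0 /eqP Pk] hmin.
have ho : has_order P k.
  apply: has_orderP => // l /andP[l0 lk]; apply/negP => Pl.
  by have := hmin l; rewrite l0 Pl leqNgt lk => /(_ isT).
by exists k => //; apply/(proj2 ho).
Qed.

Lemma cyclic_spanP P n Q : (0 < n)%N -> P *+ n = 0 -> cyclic_span P Q <->
  exists2 k, (k < n)%N & Q = P *+ k.
Proof.
move=> n0 Pn; split=> [[a _ <-]|[k _ ->]]; last by exists k%:Z.
have nz : n%:Z != 0 by rewrite eqz_nat -lt0n.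
exists `|(a %% n)%Z|%N.
  by rewrite -ltz_nat gez0_abs ?modz_ge0 // ltz_pmod // ltz_nat.
rewrite pmulrn gez0_abs ?modz_ge0 // {1}(divz_eq a n) mulrzDr.
by rewrite mulrzA mulrzAC -pmulrn Pn mul0rz add0r.
Qed.

Lemma card_cyclic_span P n : has_order P n -> (cyclic_span P #= `I_n)%card.
Proof.
move=> [n0 hP]; have Pn : P *+ n = 0 by apply/hP.
have -> : cyclic_span P = (fun k => P *+ k) @` `I_n.
  apply/seteqP; split=> Q; first by case/(cyclic_spanP Q n0 Pn) => k kn ->; exists k.
  by case=> k kn <-; exists k%:Z.
apply: inj_card_eq => k l; rewrite !inE /= => kn ln.
wlog kl : k l kn ln / (k <= l)%N => [hw|] e.
  case/orP: (leq_total k l) => h; first exact: (hw k l).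
  by apply/esym; apply: (hw l k).
have /hP/dvdnP[[|r]] : P *+ (l - k) = 0 by rewrite mulrnBr // e subrr.
  by move/eqP; rewrite mul0n subn_eq0 => lk; apply/eqP; rewrite eqn_leq kl.
by rewrite mulSn; lia.
Qed.

(** An infinite order would give n + 1 distinct multiples in a set of n elements. This turns the
    degree of a cyclic isogeny into the order of any generator of its kernel. *)
Lemma card_cyclic_span_order P n :
  (cyclic_span P #= `I_n)%card -> has_order P n.
Proof.
move=> hc.
have [k k0 Pk] : exists2 k, (0 < k)%N & P *+ k = 0.
  apply: contrapT => h.
  have inj : {in `I_n.+1 &, injective (fun k => P *+ k)}.
    move=> k l _ _; wlog kl : k l / (k <= l)%N => [hw|] e.
      case/orP: (leq_total k l) => hkl; first exact: (hw k l).
      by apply/esym; apply: (hw l k).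
    apply/eqP; rewrite eqn_leq kl leqNgt; apply/negP => lk; apply: h.
    by exists (l - k)%N; rewrite ?subn_gt0 // mulrnBr // e subrr.
  have sub : (fun k => P *+ k) @` `I_n.+1 `<=` cyclic_span P.
    by move=> Q [k _ <-]; exists k%:Z.
  have := subset_card_le sub; rewrite (card_le_eqr hc).
  by rewrite (card_le_eql (inj_card_eq inj)) card_le_II ltnn.
have [l ho _] := has_order_exists k0 Pk.
suff -> : n = l by [].
by apply/card_eq_II; rewrite -(card_eql hc); exact: card_cyclic_span.
Qed.

End Torus.

Section Isogenies.
Variable R : realType.
Implicit Types (E : lattice R).

Section Morph.
Variables (E E' : lattice R) (phi : curve E -> curve E').
Hypothesis phiD : {morph phi : P Q / P + Q}.

Lemma hom0 : phi 0 = 0.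
Proof. by apply: (addrI (phi 0)); rewrite -phiD !addr0. Qed.

Lemma homN P : phi (- P) = - phi P.
Proof. by apply/eqP; rewrite -addr_eq0 -phiD addNr hom0. Qed.

Lemma homB P Q : phi (P - Q) = phi P - phi Q.
Proof. by rewrite phiD homN. Qed.

Lemma homMn P n : phi (P *+ n) = phi P *+ n.
Proof. by elim: n => [|n IH]; rewrite ?hom0 // !mulrS phiD IH. Qed.

Lemma homMz P (n : int) : phi (P *~ n) = phi P *~ n.
Proof. by case: n => n; rewrite ?NegzE ?mulrNz ?homN -pmulrn homMn. Qed.

Lemma hom_cyclic_span P : phi @` (cyclic_span P) = cyclic_span (phi P).
Proof.
apply/seteqP; split=> Q; first by case=> _ [k _ <-] <-; exists k; rewrite ?homMz.
by case=> k _ <-; exists (P *~ k); [exists k|rewrite homMz].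
Qed.

End Morph.

Lemma holomorphic_hom_comp (E E' E'' : lattice R) (f : curve E -> curve E')
  (g : curve E' -> curve E'') :
  holomorphic_hom f -> holomorphic_hom g -> holomorphic_hom (g \o f).
Proof.
move=> [[f0 [df hf]] fD] [[g0 [dg hg]] gD]; split; last by move=> P Q /=; rewrite fD gD.
exists (g0 \o f0); split=> z /=; last by rewrite hf hg.
apply/derivable1_diffP; apply: differentiable_comp; exact/derivable1_diffP.
Qed.

Lemma maps_level_comp (G : level) m1 m2 (E E' E'' : lattice R)
  (f : curve E -> curve E') (g : curve E' -> curve E'')
  (s : level_data G E) s' s'' : {morph g : P Q / P + Q} ->
  maps_level m1 f s s' -> maps_level m2 g s' s'' ->
  maps_level (m2 * m1) (g \o f) s s''.
Proof.
move=> gD; case: G s s' s'' => /= s s' s''.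
- by move=> [-> ->] [e <-]; rewrite homMn // e mulrnA.
- by move=> -> ->.
- by move=> <- <-; rewrite image_comp.
Qed.

Lemma isomorphism_inverse (E E' : lattice R) (f : curve E -> curve E') :
  isomorphism f -> [/\ holomorphic_hom f, {morph f : P Q / P + Q} &
  exists f', [/\ {morph f' : P Q / P + Q}, cancel f f' & cancel f' f]].
Proof.
case=> hf [f' [hf' ff' f'f]]; split=> //; first by case: hf.
by exists f'; split=> //; case: hf'.
Qed.

(** The kernel is recorded because V_m is evaluated at a generator of it. *)
Lemma cyclic_isogeny_post (G : level) (N m : nat) (x y y' : enhanced R G N)
    (phi : curve x -> curve y) : enhanced_iso y y' -> cyclic_isogeny m phi ->
  exists psi : curve x -> curve y', cyclic_isogeny m psi /\ ker psi = ker phi.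
Proof.
case=> g [/isomorphism_inverse[hg gD [g' [g'D gg' _]]] lg].
case=> [[hphi [P0 P00]] deg [P kP] lev].
have kE : ker (g \o phi) = ker phi.
  apply/seteqP; split=> Q; rewrite /ker /=; [move=> e|by move=> ->; exact: hom0].
  by rewrite -(gg' (phi _)) e hom0.
exists (g \o phi); split=> //; split; rewrite /has_degree ?kE //.
- split; first exact: holomorphic_hom_comp.
  by exists P0; apply: contraNneq P00 => /= e; rewrite -(gg' (phi _)) e hom0.
- by exists P.
- by rewrite -[m]mul1n; apply: (maps_level_comp gD lev lg).
Qed.

Lemma cyclic_isogeny_pre (G : level) (N m : nat) (x' x y : enhanced R G N)
    (phi : curve x -> curve y) : enhanced_iso x' x -> cyclic_isogeny m phi ->
  exists psi : curve x' -> curve y, cyclic_isogeny m psi.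
Proof.
case=> f [/isomorphism_inverse[hf fD [f' [f'D ff' f'f]]] lf].
case=> [[hphi [P0 P00]] deg [P kP] lev].
have phiD : {morph phi : P Q / P + Q} by case: hphi.
have kE : ker (phi \o f) = cyclic_span (f' P).
  rewrite -hom_cyclic_span // -kP; apply/seteqP; split=> Q; rewrite /ker /=.
    by move=> e; exists (f Q); [|exact: ff'].
  by case=> Q' /= e <-; rewrite f'f.
have oP : has_order P m by apply: card_cyclic_span_order; rewrite -kP.
have oP' : has_order (f' P) m.
  case: oP => m0 h; split=> // k; rewrite -h -homMn //; split=> [e|->]; last exact: hom0.
  by rewrite -[LHS]f'f e hom0.
exists (phi \o f); split.
- split; first exact: holomorphic_hom_comp.
  by exists (f' P0); rewrite /= f'f.
- by rewrite /has_degree kE; apply: card_cyclic_span.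
- by exists (f' P).
- by rewrite -[m]muln1; apply: (maps_level_comp phiD lf lev).
Qed.

Lemma sublattice_hom (E E' : lattice R) :
  (forall z, torus_proj E z = 0 -> torus_proj E' z = 0) ->
  exists phi : curve E -> curve E', holomorphic_hom phi /\
    forall z, phi (torus_proj E z) = torus_proj E' z.
Proof.
move=> h; pose phi (P : curve E) : curve E' := torus_proj E' (generic_quotient.repr P).
have hphi z : phi (torus_proj E z) = torus_proj E' z.
  apply/eqP; rewrite -subr_eq0 -torus_projB; apply/eqP/h.
  rewrite torus_projB; apply/eqP; rewrite subr_eq0; apply/eqP.
  by rewrite {1}/torus_proj generic_quotient.reprK.
exists phi; split=> //; split.
  by exists id; split=> // z; apply: derivable_id.
move=> P Q; have [z ->] := torus_proj_surj P; have [w ->] := torus_proj_surj Q.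
by rewrite -torus_projD !hphi torus_projD.
Qed.

Lemma identity_isogeny (G : level) N (x : enhanced R G N) :
  cyclic_isogeny 1 (fun P : curve x => P).
Proof.
have kE : ker (fun P : curve x => P) = cyclic_span (0 : curve x).
  apply/seteqP; split=> P; first by rewrite /ker /= => ->; exists 0.
  by case=> k _ <-; rewrite /ker /= mul0rz.
have o0 : has_order (0 : curve x) 1 by split=> // k; rewrite mul0rn dvd1n.
split.
- split; first by split=> //; exists id; split=> // z; apply: derivable_id.
  exists (division_point x 2 1 0).
  by apply/eqP => /(division_point_eq0 _ _ _ (isT : (0 < 2)%N))[].
- by rewrite /has_degree kE; apply: card_cyclic_span.
- by exists 0.
- case: G x {kE o0} => x /=; [by rewrite mulr1n|by []|].
  by rewrite image_id.
Qed.

Lemma im_mobius_gt0 (t : R[i]) (a b c d : int) : 0 < complex.Im t ->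
  a * d - b * c = 1 ->
  0 < complex.Im ((a%:~R * t + b%:~R) / (c%:~R * t + d%:~R)).
Proof.
case: t => x y /= y0 det; set u := _ + b%:~R; set v := _ + d%:~R.
have detR : a%:~R * d%:~R - b%:~R * c%:~R = 1 :> R.
  by rewrite -!rmorphM -rmorphB /= det.
have v0 : v != 0.
  apply/eqP; rewrite /v !intC => /eqP; rewrite eq_complex /=.
  rewrite !(mul0r, mulr0, subr0, addr0, add0r) => /andP[/eqP h1].
  rewrite mulf_eq0 (gt_eqF y0) orbF => /eqP c0.
  move: h1; rewrite c0 mul0r add0r => d0.
  by move: detR; rewrite c0 d0 !mulr0 subrr => /eqP; rewrite eq_sym oner_eq0.
have : u / v * v = u by rewrite divfK.
case: (u / v) => t1 t2 /=; rewrite /u /v !intC => /eqP; rewrite eq_complex /=.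
rewrite !(mul0r, mulr0, subr0, addr0, add0r) => /andP[/eqP e1 /eqP e2].
move: detR e1 e2; set A : R := a%:~R; set B : R := b%:~R; set C : R := c%:~R; set D : R := d%:~R.
move=> detR e1 e2.
(* With t2 the imaginary part of the image of t, this is Im(t') |c t + d|^2 = Im(t), a consequence
   of determinant 1. *)
have key : t2 * ((C * x + D) ^+ 2 + (C * y) ^+ 2) = y.
  have -> : t2 * ((C * x + D) ^+ 2 + (C * y) ^+ 2) =
    (t1 * (C * y) + t2 * (C * x + D)) * (C * x + D)
     - (t1 * (C * x + D) - t2 * (C * y)) * (C * y) by ring.
  by rewrite e1 e2 -[RHS]mul1r -detR; ring.
have : 0 < t2 * ((C * x + D) ^+ 2 + (C * y) ^+ 2) by rewrite key.
by rewrite pmulr_lgt0 // lt_neqAle addr_ge0 ?sqr_ge0 // andbT eq_sym;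
  apply/eqP => e; move: y0; rewrite -key e mulr0 ltxx.
Qed.

Lemma expi_period (t : R) (k : int) : expi (t + 2 * pi * k%:~R) = expi t.
Proof.
have hn (n : nat) (u : R) : expi (u + 2 * pi * n%:R) = expi u.
  have -> : 2 * pi * n%:R = (pi *+ 2) *+ n :> R by rewrite mulr_natr mulr_natl.
  by rewrite /expi (periodicn (@cosD2pi R)) (periodicn (@sinD2pi R)).
case: k => n; first exact: hn.
by rewrite NegzE rmorphN /= mulrN -[LHS](hn n.+1) subrK.
Qed.

End Isogenies.

(** * Quotients by cyclic subgroups, with their level structures *)

Section Quotient.
Variable R : realType.

(** Coprime integers [a] and [b] can be completed to a matrix of determinant 1. They are reached by
    dividing arbitrary coordinates of [P] by their gcd, which is prime to [m], so that the subgroup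
    does not change. *)
Lemma primitive_generator (E : lattice R) (P : curve E) m : has_order P m ->
  exists a b : int, coprimez a b /\
    has_order (division_point E m a b) m /\
    cyclic_span P = cyclic_span (division_point E m a b).
Proof.
move=> oP; have [m0 hP] := oP.
have Pm : P *+ m = 0 by apply/hP.
have [a [b PE]] := torsion_division_point m0 Pm.
(* Both coordinates are 0 only if P = 0 and m = 1; then (1, 0) also represents the point 0. *)
have [g0|g0] := eqVneq (gcdz a b) 0.
  have /andP[/eqP a0 /eqP b0] : (a == 0) && (b == 0) by rewrite -gcdz_eq0 g0.
  have P0 : P = 0 by rewrite PE; apply/(division_point_eq0 _ _ _ m0); rewrite a0 b0 !dvdz0.
  have m1 : m = 1%N by have := (hP 1%N).1; rewrite P0 mul0rn dvdn1 => /(_ erefl)/eqP.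
  have h : division_point E m 1 0 = 0.
    by apply/(division_point_eq0 _ _ _ m0); rewrite m1 !dvd1z.
  by exists 1, 0; rewrite h -P0.
pose a0 := (a %/ gcdz a b)%Z; pose b0 := (b %/ gcdz a b)%Z; set g := gcdz a b in g0 a0 b0.
have aE : a = a0 * g by rewrite divzK // dvdz_gcdl.
have bE : b = b0 * g by rewrite divzK // dvdz_gcdr.
set P0 := division_point E m a0 b0.
have P0m : P0 *+ m = 0 by apply: division_point_torsion.
have PP0 : P = P0 *~ g by rewrite division_pointMz -aE -bE.
(* The quotient of m by d = gcd(g, m) kills P = g P0; as P has order m, this forces d = 1. *)
have cop : coprimez g m%:Z.
  rewrite /coprimez; set d := gcdz _ _.
  have dm : (d %| m%:Z)%Z by apply: dvdz_gcdr.
  have dg : (d %| g)%Z by apply: dvdz_gcdl.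
  have d0 : d != 0 by rewrite gcdz_eq0 (negPf g0).
  have [e eE] := dvdzP dm.
  have e0 : e != 0 by apply: contraTneq m0 => e0; move: eE; rewrite e0 mul0r => -[->].
  have : P *~ e = 0.
    have [f fE] := dvdzP dg.
    by rewrite PP0 -mulrzA fE -mulrA [d * e]mulrC -eE mulrzA mulrzAC -pmulrn P0m mul0rz.
  have dpos : 0 <= d by [].
  have epos : 0 <= e.
    have : 0 <= e * d by rewrite -eE.
    by rewrite pmulr_lge0 // lt_def d0.
  rewrite -(gez0_abs epos) -pmulrn => /hP /dvdnP[k kE].
  have : (e * 1 = e * (k%:Z * d))%R by rewrite mulr1 mulrCA -eE -PoszM -kE gez0_abs.
  move=> /(mulfI e0) /esym kd.
  move: dpos kd; case: d {dm dg d0 eE} => // d _ /eqP.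
  by rewrite -PoszM eqz_nat muln_eq1 => /andP[_].
have /coprimezP[[u v] /= uv] := cop.
have P0P : P0 = P *~ u.
  by rewrite -[LHS]mulr1z -uv mulrzDr [v * _]mulrC !mulrzA -pmulrn P0m
    mul0rz addr0 mulrzAC -PP0.
exists a0, b0; split.
  rewrite /coprimez -/a0; apply/eqP; apply: (mulIf g0).
  have gpos : 0 <= g by [].
  by have := mulz_gcdl a0 b0 g; rewrite -aE -bE gez0_abs // mul1r.
rewrite -/P0; split.
  split=> // k; split=> [P0k|/dvdnP[l ->]]; last by rewrite mulnC mulrnA P0m mul0rn.
  by apply/hP; rewrite PP0 pmulrn mulrzAC -pmulrn P0k mul0rz.
apply/seteqP; split=> Q [k _ <-].
  by exists (g * k) => //; rewrite mulrzA -PP0.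
by exists (u * k) => //; rewrite mulrzA -P0P.
Qed.

(* [phi] is the projection of C/L to C/(L + Z P). *)
Lemma quotient_torus (E : lattice R) (P : curve E) m : has_order P m ->
  exists (E' : lattice R) (phi : curve E -> curve E') (a b c d : int),
  [/\ holomorphic_hom phi, forall z, phi (torus_proj E z) = torus_proj E' z,
      ker phi = cyclic_span P, a * d - b * c = m%:Z &
      w1 E = a%:~R * w1 E' + b%:~R * w2 E' /\
      w2 E = c%:~R * w1 E' + d%:~R * w2 E'].
Proof.
move=> oP; have m0 : (0 < m)%N by case: oP.
have mC : m%:R != 0 :> R[i] by rewrite pnatr_eq0 -lt0n.
have [a0 [b0 [cop [oP0 ->]]]] := primitive_generator oP.
have /coprimezP[[d c0] /= cd] := cop.
have [c det] : exists c, a0 * d - b0 * c = 1 by exists (- c0); rewrite -cd; ring.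
have detC : a0%:~R * d%:~R - b0%:~R * c%:~R = 1 :> R[i].
  by rewrite -!rmorphM -rmorphB /= det.
(* The matrix with rows (a0, b0) and (c, d) gives a new basis of L; dividing its first vector by m
   yields a basis of L + Z P. The ratio v1 / v2 is the transform of w1 / w2 divided by m, which
   keeps the orientation. *)
pose v1 := (a0%:~R * w1 E + b0%:~R * w2 E) / m%:R.
pose v2 := c%:~R * w1 E + d%:~R * w2 E.
have or : 0 < complex.Im (v1 / v2).
  have := im_mobius_gt0 (lattice_oriented E) det.
  set t := (_ / _) => t0.
  have -> : v1 / v2 = t / m%:R.
    have num : a0%:~R * w1 E + b0%:~R * w2 E =
      (a0%:~R * (w1 E / w2 E) + b0%:~R) * w2 E by rewrite mulrDl -mulrA -w1E.
    have den : v2 = (c%:~R * (w1 E / w2 E) + d%:~R) * w2 E.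
      by rewrite mulrDl -mulrA -w1E.
    by rewrite /v1 num den mulrAC -mulf_div divff ?mulr1 // w2_neq0.
  have -> : t / m%:R = (m%:R^-1)%:C%C * t by rewrite mulrC fmorphV /= rmorph_nat.
  by move: t0; case: t => x y /= y0; rewrite mul0r addr0 mulr_gt0 // invr_gt0 ltr0n.
pose E' := Lattice or.
have e1 : w1 E = (d * m%:Z)%:~R * w1 E' + (- b0)%:~R * w2 E'.
  transitivity ((a0%:~R * d%:~R - b0%:~R * c%:~R) * w1 E).
    by rewrite detC mul1r.
  by rewrite /= /v1 /v2 rmorphM rmorphN /= -[m%:~R]/(m%:R); field.
have e2 : w2 E = (- c * m%:Z)%:~R * w1 E' + a0%:~R * w2 E'.
  transitivity ((a0%:~R * d%:~R - b0%:~R * c%:~R) * w2 E).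
    by rewrite detC mul1r.
  by rewrite /= /v1 /v2 rmorphM rmorphN /= -[m%:~R]/(m%:R); field.
have [z|phi [hphi phiE]] := @sublattice_hom R E E'.
  move=> /torus_proj_eq0[a [b ->]]; apply/torus_proj_eq0; rewrite e1 e2.
  exists (a * (d * m%:Z) + b * (- c * m%:Z)), (a * (- b0) + b * a0).
  by rewrite !rmorphD !rmorphM /=; ring.
exists E', phi, (d * m%:Z), (- b0), (- c * m%:Z), a0; split=> //; last first.
  by rewrite -[RHS]mul1r -det; ring.
apply/seteqP; split=> Q; have [z ->] := torus_proj_surj Q; rewrite /ker /= phiE.
  move=> /torus_proj_eq0[a [b ->]]; exists a => //.
  apply/eqP; rewrite -subr_eq0 /division_point -torus_projMz -torus_projB.
  apply/eqP/torus_proj_eq0; exists (- b * c), (- b * d).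
  by rewrite /= /v1 /v2 !rmorphM !rmorphN /= -mulrzr; ring.
case=> k _ e; rewrite -phiE -e /division_point -torus_projMz phiE.
by apply/torus_proj_eq0; exists k, 0; rewrite /= /v1 -mulrzr; ring.
Qed.

Lemma modular_inverse m N : (0 < m)%N -> coprime m N ->
  exists n t : nat, (n * m = t * N + 1)%N.
Proof.
move=> m0 /eqP mN; have [n t e _] := egcdnP N m0.
by exists n, t; rewrite e mN.
Qed.

Section QuotientLevel.
Variables (E E' : lattice R) (phi : curve E -> curve E') (m N : nat).
Hypotheses (m_gt0 : (0 < m)%N) (N_gt0 : (0 < N)%N) (mN : coprime m N).
Hypothesis phiD : {morph phi : P Q / P + Q}.
Hypothesis phi_ker : forall Q, phi Q = 0 -> Q *+ m = 0.

Lemma torsion_inverse n t (F : lattice R) (Q : curve F) :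
  (n * m = t * N + 1)%N -> Q *+ N = 0 -> Q *+ (n * m) = Q.
Proof. by move=> nm QN; rewrite nm mulrnDr mulnC mulrnA QN mul0rn add0r. Qed.

Lemma torsion_ker_eq0 Q : Q *+ N = 0 -> phi Q = 0 -> Q = 0.
Proof.
move=> QN /phi_ker Qm; have [n [t nm]] := modular_inverse m_gt0 mN.
by rewrite -(torsion_inverse nm QN) mulnC mulrnA Qm mul0rn.
Qed.

Lemma quotient_has_order Q : has_order Q N -> has_order (phi Q) N.
Proof.
case=> _ h; have QN : Q *+ N = 0 by apply/h.
split=> // k; rewrite -(homMn phiD); split=> [Qk|/h ->]; last exact: hom0.
by apply/h/torsion_ker_eq0 => //; rewrite mulrnAC QN mul0rn.
Qed.

Lemma torsion_mod (F : lattice R) (Q : curve F) k : Q *+ N = 0 ->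
  Q *+ (k %% N) = Q *+ k.
Proof.
by move=> QN; rewrite {2}(divn_eq k N) mulrnDr [(_ * N)%N]mulnC mulrnA QN mul0rn add0r.
Qed.

(** A [Gamma] isogeny of degree m has to send S to m S', which forces S' to be [phi (S *+ n)] with n
    inverse to m modulo N. *)
Lemma quotient_torsion_basis S T n t : (n * m = t * N + 1)%N ->
  (forall Q', exists Q, Q' = phi Q) ->
  is_torsion_basis N S T -> is_torsion_basis N (phi (S *+ n)) (phi T).
Proof.
move=> nm surj [SN TN basis]; rewrite /torsion /= in SN TN.
have tors Q : Q *+ N = 0 -> phi Q *+ N = 0.
  by move=> QN; rewrite -(homMn phiD) QN hom0.
have SnN : S *+ n *+ N = 0 by rewrite mulrnAC SN mul0rn.
split; [exact: tors|exact: tors|move=> T']; rewrite /torsion /= => T'N.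
(* For a preimage T0 of T', the point N T0 is in the kernel, hence killed by m. So n m T0 is
   N-torsion, and it still maps to T' because n m is 1 modulo N. *)
have [T1 T1N T1E] : exists2 T1, T1 *+ N = 0 & T' = phi T1.
  have [T0 T0E] := surj T'; exists (T0 *+ (n * m)).
    by rewrite mulrnAC [(n * m)%N]mulnC mulrnA phi_ker ?mul0rn // (homMn phiD) -T0E.
  by rewrite (homMn phiD) -T0E (torsion_inverse nm).
have [[a b] [/= abE uniq]] := basis _ T1N.
have lin a' b' : phi (S *+ n) *+ a' + phi T *+ b' = phi (S *+ (n * a') + T *+ b').
  by rewrite phiD !(homMn phiD) mulrnA.
exists (Ordinal (ltn_pmod (m * a) N_gt0), b); split=> [|[a' b']] /=.
  rewrite torsion_mod; last exact: tors.
  by rewrite lin T1E abE mulnA mulrnA (torsion_inverse nm).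
rewrite lin T1E => e.
have : T1 = S *+ (n * a') + T *+ b'.
  apply/eqP; rewrite -subr_eq0; apply/eqP/torsion_ker_eq0.
    rewrite mulrnBl mulrnDl T1N ![_ *+ _ *+ N]mulrnAC SN TN !mul0rn addr0 subr0 //.
  by rewrite homB // e subrr.
rewrite -(torsion_mod _ SN) => e1.
have [-> ->] := uniq (Ordinal (ltn_pmod (n * a') N_gt0), b') e1.
congr pair; apply: val_inj => /=; rewrite modnMmr mulnA [(m * n)%N]mulnC nm.
by rewrite mulnDl mul1n mulnAC modnMDl modn_small.
Qed.

(** Rewriting coordinates in the basis of E' multiplies the determinant by m; the factor n on the
    first point makes this n m, which is 1 modulo N. *)
Lemma quotient_weil_pairing S T n t a b c d : (n * m = t * N + 1)%N ->
  (forall z, phi (torus_proj E z) = torus_proj E' z) -> a * d - b * c = m%:Z ->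
  w1 E = a%:~R * w1 E' + b%:~R * w2 E' ->
  w2 E = c%:~R * w1 E' + d%:~R * w2 E' ->
  weil_pairing N S T (expi (2 * pi / N%:R)) ->
  weil_pairing N (phi (S *+ n)) (phi T) (expi (2 * pi / N%:R)).
Proof.
move=> nm phiE det e1 e2 [x [y [z [u [-> -> e]]]]].
have NR : N%:R != 0 :> R by rewrite pnatr_eq0 -lt0n.
exists (n%:Z * (x * a + y * c)), (n%:Z * (x * b + y * d)), (z * a + u * c), (z * b + u * d).
split.
- rewrite -torus_projMn phiE -mulr_natl e1 e2 !rmorphM !rmorphD !rmorphM /= -[n%:~R]/(n%:R).
  by congr torus_proj; ring.
- by rewrite phiE e1 e2 !rmorphD !rmorphM /=; congr torus_proj; ring.
rewrite e.
have -> : n%:Z * (x * a + y * c) * (z * b + u * d) -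
   n%:Z * (x * b + y * d) * (z * a + u * c) =
   (x * u - y * z) * ((t * N + 1)%N%:Z).
  by rewrite -nm PoszM -det; ring.
rewrite -[LHS](expi_period _ ((x * u - y * z) * t%:Z)); congr expi.
rewrite PoszD PoszM !rmorphM !rmorphD !rmorphM /= -[N%:~R]/(N%:R) -[t%:~R]/(t%:R).
by field.
Qed.

Lemma quotient_level (G : level) a b c d (s : level_data G E) :
  (forall z, phi (torus_proj E z) = torus_proj E' z) -> a * d - b * c = m%:Z ->
  w1 E = a%:~R * w1 E' + b%:~R * w2 E' ->
  w2 E = c%:~R * w1 E' + d%:~R * w2 E' ->
  is_level_structure N s ->
  exists s' : level_data G E', is_level_structure N s' /\ maps_level m phi s s'.
Proof.
move=> phiE det e1 e2; have [n [t nm]] := modular_inverse m_gt0 mN.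
case: G s => /= s.
- move=> [basis weil]; exists (phi (s.1 *+ n), phi s.2); split; last first.
    by split=> //=; rewrite -(homMn phiD) -mulrnA (torsion_inverse nm) //; case: basis.
  split=> /=; last exact: (quotient_weil_pairing nm phiE det e1 e2).
  apply: (quotient_torsion_basis nm) => // Q'.
  by have [z ->] := torus_proj_surj Q'; exists (torus_proj E z).
- by move=> oS; exists (phi s); split=> //; apply: quotient_has_order.
case=> S oS ->; exists (cyclic_span (phi S)); split; last exact: hom_cyclic_span.
by exists (phi S) => //; apply: quotient_has_order.
Qed.
End QuotientLevel.

Lemma quotient_isogeny (G : level) (N m : nat) (x : enhanced R G N)
    (P : curve x) : (0 < N)%N -> coprime m N -> has_order P m ->
  exists (y : enhanced R G N) (phi : curve x -> curve y),
    cyclic_isogeny m phi /\ ker phi = cyclic_span P.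
Proof.
move=> N0 mN oP; have m0 : (0 < m)%N by case: oP.
have [E' [phi [a [b [c [d [hphi phiE kphi det [e1 e2]]]]]]]] := quotient_torus oP.
have phiD : {morph phi : P Q / P + Q} by case: hphi.
have Pm : P *+ m = 0 by apply/(proj2 oP).
have kerm Q : phi Q = 0 -> Q *+ m = 0.
  move=> Q0; have : ker phi Q by [].
  by rewrite kphi => -[k _ <-]; rewrite pmulrn mulrzAC -pmulrn Pm mul0rz.
have [s [sP lev]] := quotient_level m0 N0 mN phiD kerm phiE det e1 e2 (estrP x).
exists (Enhanced sP), phi; split=> //; split=> //; last by exists P.
  (* The image is a half period of E', so the map is not zero. *)
  split=> //; exists (torus_proj x (w1 E' / 2)); rewrite phiE.
  have -> : torus_proj E' (w1 E' / 2) = division_point E' 2 1 0.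
    by rewrite /division_point mul1r mul0r addr0.
  by apply/eqP => /(division_point_eq0 _ _ _ (isT : (0 < 2)%N))[].
by rewrite /has_degree kphi; apply: card_cyclic_span.
Qed.

End Quotient.

(** * Division points of a model *)

Section Points.
Variables (R : realType) (E : lattice R) (q : nat).
Local Notation m := q.+2.
Implicit Types i j : pairs q.

(** One index set serves the m-torsion of all the curves E_z; the numbering is tied to the basis of
    each lattice and may jump with z. *)
Definition division_pair i : curve E := division_point E m (i.1 : nat) (i.2 : nat).

Lemma division_point_mod (a b : nat) :
  division_point E m (a %% m)%N (b %% m)%N = division_point E m a b.
Proof.
apply/eqP; rewrite -subr_eq0 division_pointN -division_pointD; apply/eqP.
have h (c : nat) : (m%:Z %| (c %% m)%N%:Z - c%:Z)%Z.
  by rewrite {2}(divn_eq c m) PoszD PoszM opprD addrCA subrr addr0 -mulNr dvdz_mull.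
by apply/division_point_eq0.
Qed.

Lemma division_pairD : {morph division_pair : i j / i + j}.
Proof.
move=> i j; rewrite /division_pair -division_pointD -!PoszD -[RHS]division_point_mod.
by congr (division_point _ _ _ _).
Qed.

Lemma division_pairB : {morph division_pair : i j / i - j}.
Proof. by move=> i j; apply/eqP; rewrite eq_sym subr_eq -division_pairD subrK. Qed.

HB.instance Definition _ := GRing.isZmodMorphism.Build (pairs q) (curve E)
  division_pair division_pairB.

Lemma division_pairN i : division_pair (- i) = - division_pair i.
Proof. exact: raddfN. Qed.

Lemma division_pairMn i k : division_pair (i *+ k) = division_pair i *+ k.
Proof. exact: raddfMn. Qed.

Lemma division_pair_eq0 i : division_pair i = 0 <-> i = 0.
Proof.
rewrite /division_pair division_point_eq0 //; split=> [|->]; last by rewrite !dvdz0.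
rewrite !dvdzE /= /dvdn => -[/eqP e1 /eqP e2].
case: i e1 e2 => a b /= e1 e2; congr pair; apply: val_inj => /=.
  by rewrite -e1 modn_small.
by rewrite -e2 modn_small.
Qed.

Lemma division_pair_inj : injective division_pair.
Proof.
move=> i j e; apply/eqP; rewrite -subr_eq0; apply/eqP/division_pair_eq0.
by rewrite division_pairB e subrr.
Qed.

Lemma division_pair_torsion i : division_pair i *+ m = 0.
Proof. exact: division_point_torsion. Qed.

Lemma torsion_division_pair (P : curve E) : P *+ m = 0 -> exists i, P = division_pair i.
Proof.
move=> /(torsion_division_point (isT : (0 < m)%N))[a [b ->]].
have red (c : int) : exists k : nat, (m%:Z %| c - k%:Z)%Z.
  exists `|(c %% m)%Z|%N; rewrite gez0_abs ?modz_ge0 //.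
  by rewrite {1}(divz_eq c m) addrK dvdz_mull.
have [k hk] := red a; have [l hl] := red b.
exists (inord (k %% m), inord (l %% m)); rewrite /division_pair !inordK ?ltn_pmod //.
rewrite division_point_mod; apply/eqP; rewrite -subr_eq0 division_pointN -division_pointD.
by apply/eqP/division_point_eq0.
Qed.

Lemma division_pair_order i : has_order (division_pair i) m <-> i \in order_set (pairs q) m.
Proof.
split=> [[_ h]|/order_setP h].
  by apply/order_setP => // k; rewrite -h -division_pairMn division_pair_eq0.
by split=> // k; rewrite -division_pairMn division_pair_eq0 h.
Qed.

Lemma cyclic_span_multiple i k : coprime k m ->
  cyclic_span (division_pair (i *+ k)) = cyclic_span (division_pair i).
Proof.
move=> km; have im : i *+ m = 0.
  by apply/division_pair_eq0; rewrite division_pairMn division_pair_torsion.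
have sub (j : pairs q) l : cyclic_span (division_pair (j *+ l)) `<=` cyclic_span (division_pair j).
  by move=> Q [a _ <-]; exists (l%:Z * a) => //; rewrite mulrzA -pmulrn -division_pairMn.
apply/seteqP; split; first exact: sub.
have [l _ e] := cyclic_block_sym (isT : (0 < m)%N) im km.
by rewrite -{1}e; apply: sub.
Qed.

End Points.

Section Specialize.
Variable R : realType.

Definition ratpoly (A : {poly {poly int}}) : {poly {poly rat}} :=
  map_poly (map_poly intr) A.

HB.instance Definition _ := GRing.RMorphism.copy ratpoly (map_poly (map_poly intr)).

Lemma int_polyE (z : R[i]) c : (int_poly R[i] c).[z] = ev z (map_poly intr c).
Proof.
rewrite evE -map_poly_comp; congr (_.[z]); apply: eq_map_poly => a /=.
by rewrite ratr_int.
Qed.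

Lemma specializeE (z : R[i]) A : specialize z A = spec z (ratpoly A).
Proof.
rewrite /specialize /spec /ratpoly -map_poly_comp; apply: eq_map_poly => c /=.
exact: int_polyE.
Qed.

Lemma intpoly_inj : injective (map_poly (intr : int -> rat)).
Proof. by apply: map_inj_poly; [exact: intr_inj|exact: rmorph0]. Qed.

Lemma ratpoly_inj : injective ratpoly.
Proof. by apply: map_inj_poly; [exact: intpoly_inj|exact: rmorph0]. Qed.

Lemma lead_coef_ratpoly A : lead_coef (ratpoly A) = map_poly intr (lead_coef A).
Proof. by rewrite lead_coef_map_inj ?rmorph0 //; exact: intpoly_inj. Qed.

End Specialize.

(** * Torsion points, division polynomials and multiplication on a model *)

Section Model.
Variables (R : realType) (G : level) (N : nat).
Variables (alpha : modular_invariant R G N) (mo : model alpha).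
Implicit Types z : R[i].

Definition cusp_poly : {poly rat} := map_poly intr (J0 alpha).

Lemma range_cusp_poly z : range alpha z <-> ev z cusp_poly != 0.
Proof.
rewrite -int_polyE; split=> [[x _ <-]|h]; first by case: (inv_j alpha x).
by apply: contrapT => nz; move/eqP: h; apply; apply: J0_root.
Qed.

Lemma cusp_poly_neq0 : cusp_poly != 0.
Proof.
case: (jfracE alpha) => _ q0 _ _.
by rewrite -(rmorph0 (map_poly (intr : int -> rat))) (inj_eq intpoly_inj).
Qed.

Section Point.
Variables (z : R[i]) (hz : range alpha z).
Local Notation x := (@mx _ _ _ _ mo z).
Implicit Types T S : curve (mcurve mo z).

Lemma mx0 : x 0 = None.
Proof.
have [T TN [T0|T0]] := (mx_eq (m := mo) hz 0 0).1 erefl.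
  by rewrite T0 add0r.
by rewrite T0 oppr0 add0r.
Qed.

Lemma mxN T : x (- T) = x T.
Proof. by apply/(mx_eq (m := mo) hz); exists 0; [exact: mx0|right; rewrite addr0]. Qed.

Lemma mxD_infty T S : x S = None -> x (T + S) = x T.
Proof. by move=> S0; apply/(mx_eq (m := mo) hz); exists S => //; left. Qed.

Lemma mxMn_infty T k : x T = None -> x (T *+ k) = None.
Proof.
move=> T0; elim: k => [|k IH]; first by rewrite mulr0n mx0.
by rewrite mulrS mxD_infty.
Qed.

Section Torsion.
Variable m : nat.
Hypotheses (m_gt0 : (0 < m)%N) (mN : coprime m N).

Lemma infty_torsion T : x T = None -> T *+ m = 0 -> T = 0.
Proof.
move=> /(mx_infty (m := mo) hz) TN Tm; have [n [t nm]] := modular_inverse m_gt0 mN.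
by rewrite -(torsion_inverse nm TN) mulnC mulrnA Tm mul0rn.
Qed.

Lemma mx_torsion_eq T S : T *+ m = 0 -> S *+ m = 0 -> x T = x S <-> T = S \/ T = - S.
Proof.
move=> Tm Sm; split=> [|[->//|->]]; last exact: mxN.
move/(mx_eq (m := mo) hz) => [U U0 [e|e]]; [left|right].
  have : U = 0; last by move=> U00; rewrite e U00 addr0.
  by apply: infty_torsion => //; rewrite -[U](addKr S) addrC -e mulrnBl Tm Sm subrr.
have : U = 0; last by move=> U00; rewrite e U00 addr0.
by apply: infty_torsion => //; rewrite -[U](addNKr S) -e mulrnDl Tm Sm addr0.
Qed.

(** [T *+ m] is at infinity, hence N-torsion, and n m acts on it as the identity; so subtracting n m
    T makes T an m-torsion point. As n m T is also at infinity, x does not change. *)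
Lemma torsion_representative T : x (T *+ m) = None ->
  exists2 T', T' *+ m = 0 & x T' = x T.
Proof.
move=> Tm; have TmN := mx_infty (m := mo) hz Tm.
have [n [t nm]] := modular_inverse m_gt0 mN.
exists (T - T *+ m *+ n).
  by rewrite mulrnBl -[_ *+ n *+ m]mulrnA (torsion_inverse nm TmN) subrr.
by rewrite mxD_infty // mxN mxMn_infty.
Qed.

End Torsion.
End Point.

Hypothesis hdiv : division_polynomials mo.
Hypothesis hmul : multiplication_rational mo.

(** A prime above [k] does not divide [k], hence not the leading coefficient [c] either. So [c] is
    nonzero, and dividing by it makes Psi_k monic over Q[X]. *)
Lemma division_polynomial (k : nat) : (0 < k)%N ->
  exists Psi : {poly {poly rat}}, Psi \is monic /\
    forall z, range alpha z -> forall (T : curve (mcurve mo z)) y,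
      mx T = Some y -> root (spec z Psi) y <-> mx (T *+ k) = None.
Proof.
move=> k0; have [Psi [[c lc hc] h]] := hdiv k0.
have c0 : c != 0.
  apply/eqP => c0.
  have [p kp pp] := prime_above k.
  have := hc p pp; rewrite c0 dvdz0 => /(_ _)/negP h0; apply: h0 => //.
  by rewrite gtnNdvd.
have cQ : (c%:~R : rat) != 0 by rewrite intr_eq0.
pose c' : {poly rat} := (c%:~R^-1)%:P.
exists (c' *: ratpoly Psi); split.
  apply/monicP; rewrite lead_coefZ lead_coef_ratpoly lc map_polyC /= -polyCM mulVf //.
move=> z hz T y Ty; rewrite specZ rootZ ?evC ?fmorph_eq0 ?invr_eq0 //.
by rewrite -specializeE -(mx0 hz) -(h z hz T y Ty); split=> /rootP.
Qed.

(** A zero of the reduced denominator at z makes x([k]T) infinite, hence is a root of Psi_k: this is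
    the hypothesis of [control_denominator]. *)
Lemma multiplication_formula (k : nat) : (0 < k)%N ->
  exists P Q : {poly {poly rat}}, forall z, range alpha z ->
    forall (T : curve (mcurve mo z)) y, mx T = Some y -> mx (T *+ k) <> None ->
    (spec z Q).[y] != 0 /\ mx (T *+ k) = Some ((spec z P).[y] / (spec z Q).[y]).
Proof.
move=> k0; have [Psi [mPsi hPsi]] := division_polynomial k0.
have [|M hM] := hmul (m := k%:Z); first by rewrite eqz_nat -lt0n.
have [z0 /range_cusp_poly hz0] := ev_neq0_ex R[i] cusp_poly_neq0.
have [A [B [MAB Bz _]]] := hM z0 hz0 0.
have B0 : B != 0.
  by apply: contraNneq Bz => ->; rewrite specializeE !rmorph0.
(* [hM] may present [M] by different fractions at different z and points; cross-multiplication ties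
   them all to the fixed [A] and [B]. *)
have rel A' B' z : M = tofrac A' / tofrac B' -> specialize z B' != 0 ->
    ratpoly A * ratpoly B' = ratpoly A' * ratpoly B.
  move=> e nB'; have B'0 : B' != 0.
    by apply: contraNneq nB' => ->; rewrite specializeE !rmorph0.
  rewrite -!rmorphM; congr ratpoly; apply/eqP.
  rewrite -tofrac_eq !rmorphM /= -eqr_div ?tofrac_eq0 //.
  by rewrite -MAB -e.
have val z (hz : range alpha z) (T : curve (mcurve mo z)) y : mx T = Some y ->
  exists A' B', [/\ ratpoly A * ratpoly B' = ratpoly A' * ratpoly B,
    spec z (ratpoly B') != 0 &
    mx (T *+ k) = ratfun_value (spec z (ratpoly A')) (spec z (ratpoly B')) (Some y)].
  move=> Ty; have [A' [B' [MAB' B'z]]] := hM z hz T.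
  rewrite Ty => e; exists A', B'; rewrite -!specializeE; split=> //.
  exact: rel B'z.
have hyp z : ev z cusp_poly != 0 -> forall y, exists A' B',
     [/\ ratpoly A * B' = A' * ratpoly B, spec z B' != 0 &
     root (spec z B' %/ gcdp (spec z A') (spec z B')) y -> root (spec z Psi) y].
  move=> /range_cusp_poly hz y; have [T Ty] := mx_surj mo hz (Some y).
  have [A' [B' [e1 e2 e3]]] := val z hz T y Ty.
  exists (ratpoly A'), (ratpoly B'); split=> // ry.
  apply/(hPsi z hz T y Ty); rewrite e3 /=.
  by rewrite (eqP ry : _ = 0) eqxx.
have RB0 : ratpoly B != 0 by rewrite -(rmorph0 ratpoly) (inj_eq ratpoly_inj).
have [n [b [A1 h]]] := control_denominator cusp_poly_neq0 RB0 hyp.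
exists A1, (b *: Psi ^+ n) => z hz T y Ty Tk.
have [bz hv] := h z ((range_cusp_poly z).1 hz).
have [A' [B' [e1 e2 e3]]] := val z hz T y Ty.
have Py : ~~ root (spec z Psi) y by apply/negP => /(hPsi z hz T y Ty).
have [nr eqv] := hv _ _ e1 e2 y Py.
have QE : (spec z (b *: Psi ^+ n)).[y] = ev z b * (spec z Psi).[y] ^+ n.
  by rewrite specZ rmorphXn /= hornerZ horner_exp.
rewrite QE; split; first by rewrite mulf_neq0 ?expf_neq0.
by rewrite e3 /= (negPf nr : (_ == 0) = false) eqv.
Qed.

End Model.

Lemma size_undup_map_eq (I : eqType) (S T : eqType) (f : I -> S) (g : I -> T) (s : seq I) :
  {in s &, forall i j, f i = f j <-> g i = g j} ->
  size (undup (map f s)) = size (undup (map g s)).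
Proof.
elim: s => //= i s IH h.
have {}IH : size (undup (map f s)) = size (undup (map g s)).
  by apply: IH => j k js ks; apply: h; rewrite in_cons ?js ?ks orbT.
have -> : (f i \in map f s) = (g i \in map g s).
  apply/mapP/mapP => -[j js e]; exists j => //.
    by apply/(h i j); rewrite ?mem_head // in_cons js orbT.
  by apply/(h i j); rewrite ?mem_head // in_cons js orbT.
by case: ifP => //= _; rewrite IH.
Qed.

(** * Polynomials whose roots are x-coordinates of torsion points *)

Section Families.
Variables (R : realType) (G : level) (N : nat).
Variables (alpha : modular_invariant R G N) (mo : model alpha).
Hypotheses (hdiv : division_polynomials mo).
Variable q : nat.
Local Notation m := q.+2.
Hypothesis mN : coprime m N.
Implicit Types (z : R[i]) (i j : pairs q) (A : {set pairs q}).
Local Notation dp z := (@division_pair R (mcurve mo z) q).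
Local Notation Omega := (order_set (pairs q) m).

(** The default 0 stands for infinity; for z in the image of [alpha] this concerns i = 0 only, by
    [mx_coord]. *)
Definition coord z i : R[i] := odflt 0 (mx (dp z i)).

Definition coord_family A z := undup [seq coord z i | i <- enum A].

Lemma order_set_neq0 i : i \in Omega -> i != 0.
Proof.
move=> /order_setP h; apply/eqP => i0.
by have := (h isT 1%N).1; rewrite i0 mul0rn dvdn1 => /(_ erefl).
Qed.

Lemma mx_coord z i : range alpha z -> i != 0 -> mx (dp z i) = Some (coord z i).
Proof.
move=> hz i0; rewrite /coord; case e : (mx (dp z i)) => [y|]; first by [].
move/negP: i0; case; apply/eqP/(division_pair_eq0 (mcurve mo z)).
exact: (infty_torsion hz (isT : (0 < m)%N) mN e (division_pair_torsion _ i)).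
Qed.

Lemma coord_eq z i j : range alpha z -> i != 0 -> j != 0 ->
  coord z i = coord z j <-> i = j \/ i = - j.
Proof.
move=> hz i0 j0; have := mx_torsion_eq hz (isT : (0 < m)%N) mN
  (division_pair_torsion (mcurve mo z) i) (division_pair_torsion (mcurve mo z) j).
rewrite !mx_coord // -division_pairN => h; split.
  by move=> e; have := h.1 (congr1 Some e) => -[/division_pair_inj|/division_pair_inj]; auto.
by move=> h'; have [] : Some (coord z i) = Some (coord z j); [apply/h; case: h' => ->; auto|].
Qed.

Lemma mx_division_pair_infty z i d : range alpha z ->
  mx (dp z i *+ d) = None <-> i *+ d = 0.
Proof.
move=> hz; rewrite -division_pairMn; split=> [e|->]; last by rewrite raddf0 mx0.
apply/(division_pair_eq0 (mcurve mo z)).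
by apply: (infty_torsion hz (isT : (0 < m)%N) mN e); apply: division_pair_torsion.
Qed.

Lemma mem_coord_family A z i : i \in A -> coord z i \in coord_family A z.
Proof. by move=> iA; rewrite mem_undup map_f // mem_enum. Qed.

(** At every z, coordinates coincide exactly for equal or opposite indices. So the number of
    distinct values is constant, as [rational_family] requires. *)
Lemma coord_family_polynomial A K : {in A, forall i, i != 0} -> K \is monic ->
  (forall z, range alpha z -> forall i, i != 0 ->
     root (spec z K) (coord z i) = (i \in A)) ->
  (forall z, range alpha z -> forall y, root (spec z K) y ->
     exists2 T : curve (mcurve mo z), T *+ m = 0 & mx T = Some y) ->
  exists2 k : {poly {poly rat}}, k \is monic & forall z, range alpha z ->
    spec z k = \prod_(y <- coord_family A z) ('X - y%:P).
Proof.
move=> A0 mK rK tK.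
have [z0 /range_cusp_poly hz0] := ev_neq0_ex R[i] (cusp_poly_neq0 alpha).
have [|||k mk kz] := rational_family (cusp_poly_neq0 alpha) mK
    (F := coord_family A) (n := size (coord_family A z0)).
- by move=> z _; apply: undup_uniq.
- move=> z /range_cusp_poly hz; apply: size_undup_map_eq => i j.
  by rewrite !mem_enum => /A0 i0 /A0 j0; rewrite !coord_eq.
- move=> z /range_cusp_poly hz y; rewrite mem_undup; apply/idP/mapP => [ry|]; last case=> i.
    have [T Tm Ty] := tK z hz y ry.
    have [i e] := torsion_division_pair Tm.
    have i0 : i != 0.
      by apply: contra_eqN Ty => /eqP i0; rewrite e i0 raddf0 mx0.
    have ye : y = coord z i by have := mx_coord hz i0; rewrite -e Ty => -[].
    by exists i => //; rewrite mem_enum -(rK z hz i i0) -ye.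
  by rewrite mem_enum => iA ->; rewrite [_ \in _]rK ?A0.
by exists k => // z /range_cusp_poly; apply: kz.
Qed.

Lemma torsion_polynomial : exists2 g : {poly {poly rat}}, g \is monic &
  forall z, range alpha z ->
    spec z g = \prod_(y <- coord_family [set i | i != 0] z) ('X - y%:P).
Proof.
have [Psi [mPsi hPsi]] := division_polynomial hdiv (isT : (0 < m)%N).
apply: (coord_family_polynomial (K := Psi)) => //.
- by move=> i; rewrite inE.
- move=> z hz i i0; rewrite inE i0; apply/(hPsi z hz _ _ (mx_coord hz i0)).
  by rewrite division_pair_torsion mx0.
- move=> z hz y ry; have [T Ty] := mx_surj mo hz (Some y).
  have [T' T'm T'y] := torsion_representative hz (isT : (0 < m)%N) mN ((hPsi z hz T y Ty).1 ry).
  by exists T'; rewrite ?T'y.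
Qed.

Lemma imprimitive_polynomial : exists2 k : {poly {poly rat}}, k \is monic &
  forall z, range alpha z -> spec z k =
    \prod_(y <- coord_family [set i | (i != 0) && (i \notin Omega)] z) ('X - y%:P).
Proof.
have ex (k : nat) : exists Psi : {poly {poly rat}}, (0 < k)%N ->
    Psi \is monic /\ forall z, range alpha z -> forall (T : curve (mcurve mo z)) y,
      mx T = Some y -> root (spec z Psi) y <-> mx (T *+ k) = None.
  case: (posnP k) => [->|k0]; first by exists 0.
  by have [Psi h] := division_polynomial hdiv k0; exists Psi.
have [Psi hPsi] := choice ex.
pose D := [seq d <- divisors m | (d < m)%N].
have memD d : d \in D = (d %| m)%N && (d < m)%N by rewrite mem_filter -dvdn_divisors // andbC.
have D0 d : d \in D -> (0 < d)%N by rewrite memD => /andP[/dvdn_gt0 ->].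
(* A point of E[m] fails to have order m exactly when a proper divisor d of m kills it. Every root
   of Psi_d is the coordinate of a d-torsion point, by [torsion_representative]. *)
pose K := \prod_(d <- D) Psi d.
have rootK z (hz : range alpha z) (T : curve (mcurve mo z)) y : mx T = Some y ->
    root (spec z K) y <-> exists2 d, d \in D & mx (T *+ d) = None.
  move=> Ty; rewrite /K rmorph_prod /root horner_prod prodf_seq_eq0.
  split=> [/hasP[d dD /= ry]|[d dD e]]; last first.
    by apply/hasP; exists d => //=; apply/((hPsi d (D0 d dD)).2 z hz T y Ty).
  by exists d => //; apply/((hPsi d (D0 d dD)).2 z hz T y Ty).
apply: (coord_family_polynomial (K := K)).
- by move=> i; rewrite inE => /andP[].
- by rewrite /K big_seq; apply: monic_prod => d /D0/hPsi[].
- move=> z hz i i0; rewrite inE i0 /=; apply/idP/idP.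
    move=> /(rootK z hz _ _ (mx_coord hz i0))[d dD /(mx_division_pair_infty _ _ hz) e].
    apply/negP => /order_setP h; move: (dD); rewrite memD => /andP[_].
    by rewrite ltnNge dvdn_leq ?D0 //; apply/(h isT).
  move=> io; apply/(rootK z hz _ _ (mx_coord hz i0)).
  have [d od dm] := has_order_exists (isT : (0 < m)%N) (division_pair_torsion (mcurve mo z) i).
  have dD : d \in D.
    rewrite memD dm ltn_neqAle dvdn_leq // andbT; apply: contraNneq io => dE.
    by apply/(division_pair_order (mcurve mo z)); rewrite -dE.
  exists d => //.
  have -> : dp z i *+ d = 0 by apply/(proj2 od).
  exact: mx0.
- move=> z hz y ry; have [T Ty] := mx_surj mo hz (Some y).
  have [d dD Td] := (rootK z hz T y Ty).1 ry.
  have dm : (d %| m)%N by move: dD; rewrite memD => /andP[].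
  have [T' T'd T'y] := torsion_representative hz (D0 d dD) (coprime_dvdl dm mN) Td.
  exists T'; last by rewrite T'y.
  by have [e ->] := dvdnP dm; rewrite mulnC mulrnA T'd mul0rn.
Qed.

(** [i] and [- i] have the same order, so the coordinates in order m and in smaller orders are
    disjoint, and the two products multiply to [g] at each z. As [k] is monic, the quotient has
    coefficients in Q[X]. *)
Lemma primitive_polynomial : exists2 h : {poly {poly rat}}, h \is monic &
  forall z, range alpha z -> spec z h = \prod_(y <- coord_family Omega z) ('X - y%:P).
Proof.
have [g mg gz] := torsion_polynomial; have [k mk kz] := imprimitive_polynomial.
have split z : range alpha z ->
    spec z g = spec z k * \prod_(y <- coord_family Omega z) ('X - y%:P).
  move=> hz; rewrite gz // kz // -big_cat /=; apply: perm_big; apply: uniq_perm.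
  - exact: undup_uniq.
  - rewrite cat_uniq !undup_uniq /= andbT; apply/hasPn => y /=.
    rewrite !mem_undup => /mapP[ i]; rewrite mem_enum => io ->; apply/negP => /mapP[j].
    rewrite mem_enum inE => /andP[j0 jo] /(coord_eq hz (order_set_neq0 io) j0) h.
    case/negP: jo; case: h io => -> // /order_setP h; apply/order_setP => // l.
    rewrite -(h isT l) mulNrn; split=> [->|/eqP]; first by rewrite oppr0.
    by rewrite oppr_eq0 => /eqP.
  move=> y; rewrite mem_cat !mem_undup; apply/mapP/orP => [|]; first case=> i.
    rewrite mem_enum inE => i0 ->; case: (boolP (i \in Omega)) => io; [right|left].
      by apply: map_f; rewrite mem_enum.
    by apply: map_f; rewrite mem_enum inE i0.
  case=> /mapP[ i]; rewrite mem_enum ?inE => iA ->; exists i => //; rewrite mem_enum inE.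
    by case/andP: iA.
  by apply: order_set_neq0; rewrite inE.
have [h gE] : exists h, g = h * k.
  apply: (spec_dvd_monic (cusp_poly_neq0 alpha) mk (C := R[i])) => z /range_cusp_poly hz.
  by rewrite split // dvdp_mulr.
exists h; first by rewrite -(monicMr _ mk) -gE.
move=> z hz; have k0 : spec z k != 0 by rewrite monic_neq0 ?spec_monic.
by apply: (mulIf k0); rewrite -rmorphM /= -gE split // mulrC.
Qed.

End Families.

(** * The modular polynomial *)

Section Regular.
Variables (C : numClosedFieldType) (adm : C -> C -> Prop).

(** A single fraction serves all admissible points, and its denominator vanishes at none of them.
    Such functions are stable under sums and products, so V_m can be applied to them. *)
Definition regular (f : C -> C -> C) := exists H D : {poly {poly rat}},
  forall z y, adm z y -> (spec z D).[y] != 0 /\ f z y = (spec z H).[y] / (spec z D).[y].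

Lemma regular_quotient (H D : {poly {poly rat}}) :
  (forall z y, adm z y -> (spec z D).[y] != 0) ->
  regular (fun z y => (spec z H).[y] / (spec z D).[y]).
Proof. by move=> h; exists H, D => z y /h. Qed.

Lemma regular_poly (H : {poly {poly rat}}) : regular (fun z y => (spec z H).[y]).
Proof. by exists H, 1 => z y _; rewrite rmorph1 hornerC divr1 oner_neq0. Qed.

Lemma regular_const (a : rat) : regular (fun _ _ => ratr a).
Proof.
have [H [D h]] := regular_poly a%:P%:P; exists H, D => z y /h[h1 h2]; split=> //.
by rewrite -h2 specC hornerC evC.
Qed.

Lemma regularD f g : regular f -> regular g -> regular (fun z y => f z y + g z y).
Proof.
move=> [H1 [D1 h1]] [H2 [D2 h2]]; exists (H1 * D2 + H2 * D1), (D1 * D2) => z y adm_zy.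
have [n1 ->] := h1 z y adm_zy; have [n2 ->] := h2 z y adm_zy.
rewrite rmorphD !rmorphM /= hornerD !hornerM mulf_neq0 //; split=> //.
by rewrite addf_div.
Qed.

Lemma regularM f g : regular f -> regular g -> regular (fun z y => f z y * g z y).
Proof.
move=> [H1 [D1 h1]] [H2 [D2 h2]]; exists (H1 * H2), (D1 * D2) => z y adm_zy.
have [n1 ->] := h1 z y adm_zy; have [n2 ->] := h2 z y adm_zy.
by rewrite !rmorphM /= !hornerM mulf_neq0 //; split=> //; rewrite mulf_div.
Qed.

Lemma regular_exp f n : regular f -> regular (fun z y => f z y ^+ n).
Proof.
move=> rf; elim: n => [|n IH].
  have [H [D h]] := regular_const 1; exists H, D => z y /h.
  by rewrite rmorph1 expr0.
have [H [D h]] := regularM rf IH; exists H, D => z y /h.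
by rewrite exprS.
Qed.

Lemma regular_sum (I : Type) (s : seq I) (f : I -> C -> C -> C) :
  (forall i, regular (f i)) -> regular (fun z y => \sum_(i <- s) f i z y).
Proof.
move=> rf; elim: s => [|i s IH].
  have [H [D h]] := regular_const 0; exists H, D => z y /h.
  by rewrite rmorph0 big_nil.
have [H [D h]] := regularD (rf i) IH; exists H, D => z y /h.
by rewrite big_cons.
Qed.

Lemma regular_prod (I : Type) (s : seq I) (f : I -> C -> C -> C) :
  (forall i, regular (f i)) -> regular (fun z y => \prod_(i <- s) f i z y).
Proof.
move=> rf; elim: s => [|i s IH].
  have [H [D h]] := regular_const 1; exists H, D => z y /h.
  by rewrite rmorph1 big_nil.
have [H [D h]] := regularM (rf i) IH; exists H, D => z y /h.
by rewrite big_cons.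
Qed.

Lemma regular_meval n (V : mpoly.mpoly n rat) (w : C -> C -> 'I_n -> C) :
  (forall k, regular (fun z y => w z y k)) ->
  regular (fun z y => mpoly.meval (w z y) (mpoly.map_mpoly ratr V)).
Proof.
move=> rw.
have [|H [D h]] := @regular_sum _ (mpoly.msupp (mpoly.map_mpoly (ratr : rat -> C) V))
  (fun mon z y => ratr (mpoly.mcoeff mon V) *
     \prod_(k < n) w z y k ^+ (mpoly.fun_of_multinom mon k)).
  move=> mon; apply: regularM; first exact: regular_const.
  by apply: regular_prod => k; apply: regular_exp.
exists H, D => z y /h[h1 h2]; split=> //; rewrite -h2 mpoly.mevalE.
by apply: eq_bigr => mon _; rewrite mpoly.mcoeff_map_mpoly.
Qed.

End Regular.

Lemma meval_bounded (C : numClosedFieldType) n (V : mpoly.mpoly n C) (M : C) :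
  exists M' : C, forall v : 'I_n -> C, (forall k, `|v k| <= M) -> `|mpoly.meval v V| <= M'.
Proof.
exists (\sum_(mon <- mpoly.msupp V) `|mpoly.mcoeff mon V| *
  \prod_(k < n) `|M| ^+ (mpoly.fun_of_multinom mon k)) => v vM.
rewrite mpoly.mevalE (le_trans (ler_norm_sum _ _ _)) //; apply: ler_sum => mon _.
rewrite normrM ler_wpM2l // normr_prod; apply: ler_prod => k _.
rewrite normr_ge0 /= normrX lerXn2r ?nnegrE //.
by rewrite (le_trans (vM k)) // real_ler_norm // ger0_real // (le_trans _ (vM k)).
Qed.

(** * Invariants of the quotient curves *)

Section Values.
Variables (R : realType) (G : level) (N : nat).
Variables (alpha : modular_invariant R G N) (mo : model alpha).
Hypotheses (N_gt0 : (0 < N)%N) (hgood : good_model mo).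
Variable q : nat.
Local Notation m := q.+2.
Hypothesis mN : coprime m N.
Implicit Types (z : R[i]) (i j : pairs q).
Local Notation dp z := (@division_pair R (mcurve mo z) q).
Local Notation Omega := (order_set (pairs q) m).
Local Notation coord := (coord mo).

Lemma coord_multiple k : (0 < k < m)%N -> exists P Q : {poly {poly rat}},
  forall z i, range alpha z -> i \in Omega ->
    (spec z Q).[coord z i] != 0 /\
    coord z (i *+ k) = (spec z P).[coord z i] / (spec z Q).[coord z i].
Proof.
case/andP=> k0 km; have [hmul hdiv _] := hgood.
have [P [Q h]] := multiplication_formula hdiv hmul k0.
exists P, Q => z i hz io; have i0 := order_set_neq0 io.
have ik0 : i *+ k != 0.
  have /order_setP h' := io; apply/eqP => /(h' isT)/(dvdn_leq k0).
  by rewrite leqNgt km.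
have e := mx_coord mo mN hz ik0.
have [|h1 h2] := h z hz _ _ (mx_coord mo mN hz i0); first by rewrite -division_pairMn e.
by split=> //; move: h2; rewrite -division_pairMn e => -[].
Qed.

Definition kernel_coords z i (k : 'I_m) : R[i] :=
  if k == 0 :> nat then z else coord z (i *+ k).

(** [isogeny_polynomials] concerns isogenies between the chosen curves of the model; composing with
    an isomorphism to [mcurve mo (alpha y)] reaches any target and keeps the kernel. *)
Lemma isogeny_value : exists V : mpoly.mpoly m rat,
  forall z (y : enhanced R G N) (phi : curve (mcurve mo z) -> curve y) i,
    range alpha z -> i \in Omega -> cyclic_isogeny m phi ->
    ker phi = cyclic_span (dp z i) ->
    alpha y = mpoly.meval (kernel_coords z i) (mpoly.map_mpoly ratr V).
Proof.
have [_ _ hiso] := hgood; have [V [_ hV]] := hiso m isT mN.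
exists V => z y phi i hz io cphi kphi.
have hz' : range alpha (alpha y) by exists y.
have iso : enhanced_iso y (mcurve mo (alpha y)).
  by apply/(Defs.inv_inj alpha); rewrite (mcurveP mo hz').
have [psi [cpsi kpsi]] := cyclic_isogeny_post iso cphi.
apply: (hV z (alpha y) hz hz' psi cpsi (dp z i)); first by rewrite kpsi.
move=> k; rewrite /kernel_coords; case: eqP => // k0.
rewrite -division_pairMn mx_coord //; apply/eqP; have /order_setP h := io.
move=> /(h isT)/dvdn_leq; rewrite lt0n leqNgt ltn_ord => h'.
by apply: k0; apply/eqP/negPn/negP => /h'.
Qed.

Lemma isogeny_targets : exists t : R[i] -> pairs q -> R[i],
  forall z i, range alpha z -> i \in Omega ->
  exists (y : enhanced R G N) (phi : curve (mcurve mo z) -> curve y),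
    [/\ t z i = alpha y, cyclic_isogeny m phi & ker phi = cyclic_span (dp z i)].
Proof.
have ex (p : R[i] * pairs q) : exists w : R[i], range alpha p.1 -> p.2 \in Omega ->
  exists (y : enhanced R G N) (phi : curve (mcurve mo p.1) -> curve y),
    [/\ w = alpha y, cyclic_isogeny m phi & ker phi = cyclic_span (dp p.1 p.2)].
  case: (pselect (range alpha p.1 /\ p.2 \in Omega)) => [[hz io]|h]; last first.
    by exists 0 => h1 h2; case: h.
  have [y [phi [cphi kphi]]] := quotient_isogeny N_gt0 mN
    ((division_pair_order (mcurve mo p.1) p.2).2 io).
  by exists (alpha y) => _ _; exists y, phi.
have [t ht] := choice ex; exists (fun z i => t (z, i)) => z i.
exact: (ht (z, i)).
Qed.

End Values.

Lemma horner_specialization (C : numClosedFieldType) (P : {poly {poly rat}}) (z w : C) :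
  (map_poly (map_poly ratr) P).[w%:P].[z] = (spec z P).[w].
Proof.
rewrite -[LHS]/(horner_eval z _) -horner_map; congr (_.[_]); last exact: hornerC.
by apply/polyP => i; rewrite spec_coef !coef_map.
Qed.

Section ModularPolynomial.
Variables (R : realType) (G : level) (N : nat).
Variables (alpha : modular_invariant R G N) (mo : model alpha).
Hypotheses (N_gt0 : (0 < N)%N) (hgood : good_model mo).
Implicit Types z : R[i].

Lemma cyclic_isogeny_mcurve m (x y : enhanced R G N) :
  (exists phi : curve x -> curve y, cyclic_isogeny m phi) <->
  (exists phi : curve (mcurve mo (alpha x)) -> curve y, cyclic_isogeny m phi).
Proof.
have rx : range alpha (alpha x) by exists x.
have e := mcurveP mo rx.
split=> -[phi c]; apply: cyclic_isogeny_pre c; apply/(Defs.inv_inj alpha); by rewrite e.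
Qed.

(* Applied to the identity, [V_1] gives [z = V_1(z)]; as [V_1] depends on [z]
   only, an isogeny of degree 1 preserves [alpha]. *)
Lemma modular_polynomial_1 : exists Phi : {poly {poly rat}},
  is_modular_polynomial alpha 1 (map_poly (map_poly ratr) Phi).
Proof.
exists ('X - 'X%:P); split.
- by rewrite monic_map // monicXsubC.
- by rewrite size_map_inj_poly ?rmorph0 ?size_XsubC /psi ?big_nil ?mulr1 //; apply: map_poly_inj.
move=> x y; rewrite horner_specialization rmorphB /= specC /spec map_polyX !hornerE.
rewrite evE map_polyX hornerX; split=> [/eqP|[phi cphi]].
  rewrite subr_eq0 => /eqP e.
  have iso : enhanced_iso x y by apply/(Defs.inv_inj alpha).
  have [psi [cpsi _]] := cyclic_isogeny_post iso (identity_isogeny x).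
  by exists psi.
have rx : range alpha (alpha x) by exists x.
have ry : range alpha (alpha y) by exists y.
have [psi cpsi] := (cyclic_isogeny_mcurve 1 x y).1 (ex_intro _ phi cphi).
have iso : enhanced_iso y (mcurve mo (alpha y)).
  by apply/(Defs.inv_inj alpha); rewrite (mcurveP mo ry).
have [chi [cchi _]] := cyclic_isogeny_post iso cpsi.
have [_ _ hiso] := hgood; have [V [_ hV]] := hiso 1%N isT (coprime1n N).
have val z z' (rz : range alpha z) (rz' : range alpha z')
    (f : curve (mcurve mo z) -> curve (mcurve mo z')) : cyclic_isogeny 1 f ->
    z' = mpoly.meval (fun _ => z) (mpoly.map_mpoly ratr V).
  move=> cf; have [_ _ [T kT] _] := cf.
  apply: (hV z z' rz rz' f cf T kT) => k.
  by have := ltn_ord k; rewrite ltnS leqn0 => ->.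
apply/eqP; rewrite subr_eq0; apply/eqP.
by rewrite (val _ _ rx ry chi cchi) -(val _ _ rx rx _ (identity_isogeny _)).
Qed.

Section Degree.
Variable q : nat.
Local Notation m := q.+2.
Hypothesis mN : coprime m N.
Local Notation Omega := (order_set (pairs q) m).
Local Notation dp z := (@division_pair R (mcurve mo z) q).
Implicit Types i j : pairs q.

Lemma rational_targets (t : R[i] -> pairs q -> R[i]) (V : mpoly.mpoly m rat) :
  (forall z i, range alpha z -> i \in Omega ->
     t z i = mpoly.meval (kernel_coords mo z i) (mpoly.map_mpoly ratr V)) ->
  exists H D : {poly {poly rat}}, forall z i, range alpha z -> i \in Omega ->
    (spec z D).[coord mo z i] != 0 /\
    t z i = (spec z H).[coord mo z i] / (spec z D).[coord mo z i].
Proof.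
move=> ht.
(* At coordinates of points T of exact order m, every x([k]T) with 0 < k < m is finite, so the
   multiplication formulas have no pole there. *)
pose adm z y := range alpha z /\ exists2 i, i \in Omega & y = coord mo z i.
have ex (k : 'I_m) : exists w : R[i] -> R[i] -> R[i], regular adm w /\
    forall z i, range alpha z -> i \in Omega -> kernel_coords mo z i k = w z (coord mo z i).
  rewrite /kernel_coords; case: eqP => [_|/eqP k0].
    exists (fun z _ => z); split=> //.
    have [H [D h]] := @regular_poly _ adm 'X%:P; exists H, D => z y /h.
    by rewrite specC hornerC evE map_polyX hornerX.
  have [|P [Q h]] := coord_multiple hgood mN (k := k).
    by rewrite lt0n k0 ltn_ord.
  exists (fun z y => (spec z P).[y] / (spec z Q).[y]); split.
    by apply: regular_quotient => z y [hz [i io ->]]; case: (h z i hz io).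
  by move=> z i hz io; case: (h z i hz io).
have [w hw] := choice ex.
have [|H [D h]] := @regular_meval _ adm m V (fun z y k => w k z y).
  by move=> k; case: (hw k).
exists H, D => z i hz io; have [|h1 h2] := h z (coord mo z i); first by split=> //; exists i.
split=> //; rewrite ht // -h2; congr mpoly.meval; apply/funext => k.
by case: (hw k) => _ ->.
Qed.

(** V_m is a polynomial, so its values are bounded once its arguments are. The multiples of a point
    of order m may have smaller order; hence the bound comes from the polynomial of all nonzero
    m-torsion. *)
Lemma targets_bounded (t : R[i] -> pairs q -> R[i]) (V : mpoly.mpoly m rat) :
  (forall z i, range alpha z -> i \in Omega ->
     t z i = mpoly.meval (kernel_coords mo z i) (mpoly.map_mpoly ratr V)) ->
  locally_bounded (cusp_poly alpha) (fun z => [seq t z i | i <- enum Omega]).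
Proof.
move=> ht B; have [_ hdiv _] := hgood.
have [g mg gz] := torsion_polynomial hdiv mN.
have [|M hM] := @roots_locally_bounded _ g (cusp_poly alpha)
  (coord_family mo [set i : pairs q | i != 0]%SET) mg _ B.
  by move=> z /range_cusp_poly hz y yF; rewrite gz // root_prod_XsubC.
have [M' hM'] := meval_bounded (mpoly.map_mpoly ratr V) (`|M| + `|B|).
exists M' => z zB /range_cusp_poly hz y /mapP[j]; rewrite mem_enum => jo ->.
rewrite ht //; apply: hM' => k; rewrite /kernel_coords; case: eqP => [_|k0].
  by rewrite (le_trans zB) // ler_wpDl // real_ler_norm // ger0_real // (le_trans _ zB).
have jk0 : j *+ k != 0.
  apply/eqP; have /order_setP h := jo; move=> /(h isT)/dvdn_leq.
  rewrite lt0n leqNgt ltn_ord => h'.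
  by apply: k0; apply/eqP/negPn/negP => /h'.
have := hM z zB ((range_cusp_poly alpha z).1 hz) (coord mo z (j *+ k)).
rewrite mem_coord_family ?inE // => /(_ isT) le1.
by rewrite (le_trans le1) // ler_wpDr // real_ler_norm // ger0_real // (le_trans _ le1).
Qed.

Lemma target_polynomial (t : R[i] -> pairs q -> R[i]) (V : mpoly.mpoly m rat) :
  (forall z i, range alpha z -> i \in Omega ->
     t z i = mpoly.meval (kernel_coords mo z i) (mpoly.map_mpoly ratr V)) ->
  exists2 F : {poly {poly rat}}, F \is monic & forall z, range alpha z ->
    \prod_(i in Omega) ('X - (t z i)%:P) = spec z F ^+ (m != 2).+1.
Proof.
move=> ht; have [_ hdiv _] := hgood.
have [H [D hHD]] := rational_targets ht.
have [h mh hz] := primitive_polynomial hdiv mN.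
have [z0 rz0] := ev_neq0_ex R[i] (cusp_poly_neq0 alpha).
have hz0 := (range_cusp_poly alpha z0).2 rz0.
pose fam z := coord_family mo Omega z.
have memfam z y : y \in fam z -> exists2 i, i \in Omega & y = coord mo z i.
  by rewrite mem_undup => /mapP[j]; rewrite mem_enum => jo ->; exists j.
pose s := size (fam z0).
have sh : size h = s.+1 by rewrite -(size_spec_monic z0 mh) hz // size_prod_XsubC.
have sfam z : range alpha z -> size (fam z) = s.
  move=> rz; apply: succn_inj; rewrite -sh -(size_spec_monic z mh) hz //.
  by rewrite size_prod_XsubC.
(* A point of order m exists, so [h] has positive degree, as the companion matrix in [norm_family]
   requires. *)
have one_o : (1, 0) \in Omega.
  apply/(division_pair_order (mcurve mo z0)); split=> // k.
  rewrite /division_pair division_pointMn division_point_eq0 // mul1r mul0r dvdz0.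
  by split=> [[]|].
have s_gt0 : (0 < s)%N.
  rewrite /s -has_predT; apply/hasP; exists (coord mo z0 ((1, 0) : pairs q)) => //.
  exact: mem_coord_family.
have sh2 : size h = s.-1.+2 by rewrite prednK.
have [P hP] := @norm_family R[i] h D H _ mh sh2.
pose f z y := (spec z H).[y] / (spec z D).[y].
pose d z := \prod_(y <- fam z) (spec z D).[y].
have d0 z : range alpha z -> d z != 0.
  move=> rz; rewrite prodf_seq_neq0; apply/allP => y /memfam[j jo ->].
  by case: (hHD z j rz jo).
have PE z : range alpha z ->
    spec z P = d z *: \prod_(x <- [seq f z y | y <- fam z]) ('X - x%:P).
  move=> rz; rewrite (hP z (fam z)) ?hz // big_map /d -scaler_prod; apply: eq_big_seq => y.
  move=> /memfam[j jo ->]; case: (hHD z j rz jo) => nz _.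
  by rewrite scalerBr -[_ *: _%:P]mul_polyC -polyCM [_ * f _ _]mulrC divfK.
(* The leading coefficient of the norm at z is the product of the denominators, nonzero at every z
   in the image of [alpha]; this is why [hF] will apply to all of them. *)
have qE z : range alpha z -> ev z P`_s = d z.
  move=> rz; rewrite -spec_coef PE // coefZ.
  have := monic_prod_XsubC [seq f z y | y <- fam z] xpredT id.
  by move=> /monicP; rewrite lead_coefE size_prod_XsubC size_map sfam //= => ->; rewrite mulr1.
have q0 : P`_s != 0.
  by apply: contraNneq (d0 _ hz0) => e; rewrite -qE // e rmorph0.
have bF : locally_bounded (cusp_poly alpha) (fun z => [seq f z y | y <- fam z]).
  move=> B; have [M hM] := targets_bounded ht B.
  exists M => z zB cz x /mapP[y /memfam[j jo ->] ->]; apply: (hM z zB cz).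
  have rz := (range_cusp_poly alpha z).2 cz.
  by rewrite /f -(hHD z j rz jo).2; apply: map_f; rewrite mem_enum.
have [z|z|F mF hF] := monic_of_locally_bounded (cusp_poly_neq0 alpha) q0 bF (n := s) (P := P).
- by move=> /range_cusp_poly rz; rewrite size_map sfam.
- by move=> /range_cusp_poly rz; rewrite PE // qE.
exists F => // z rz; rewrite hF; last first.
  by rewrite rmorphM mulf_neq0 //= ?qE ?d0 //; apply/range_cusp_poly.
rewrite big_map -[RHS](prod_order_set (isT : (0 < m)%N) (x := coord mo z)
  (fun y => 'X - (f z y)%:P)) //.
  by apply: eq_bigr => j jo; rewrite (hHD z j rz jo).2.
by move=> i j io jo; apply: coord_eq => //; apply: order_set_neq0.
Qed.

Lemma modular_polynomial_ge2 : exists Phi : {poly {poly rat}},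
  is_modular_polynomial alpha m (map_poly (map_poly ratr) Phi).
Proof.
have [V hV] := isogeny_value hgood mN.
have [t ht] := isogeny_targets mo N_gt0 mN.
have tV z i : range alpha z -> i \in Omega ->
    t z i = mpoly.meval (kernel_coords mo z i) (mpoly.map_mpoly ratr V).
  move=> rz io; have [y [phi [-> cphi kphi]]] := ht z i rz io.
  exact: hV kphi.
have [F mF hF] := target_polynomial tV.
have [r [r1 r2 r3 r4]] := @cyclic_representatives (pairs q) m isT {poly R[i]}.
(* [i] and [i *+ k] generate the same kernel, and V_m gives the same value at every generator. *)
have tinv z i k : range alpha z -> i \in Omega -> coprime k m -> t z (i *+ k) = t z i.
  move=> rz io km; have iko := order_set_mul (isT : (0 < m)%N) io km.
  have [y [phi [-> cphi kphi]]] := ht z _ rz iko.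
  rewrite (tV z i) //; apply: hV cphi _ => //.
  by rewrite kphi cyclic_span_multiple.
have [z0 /range_cusp_poly rz0] := ev_neq0_ex R[i] (cusp_poly_neq0 alpha).
(* The power of [F] restores the product over all points of order m, which is then grouped by cyclic
   subgroups, each having [totient m] generators. *)
have prodE z : range alpha z ->
    spec z (F ^+ (m != 2).+1) = (\prod_(i <- r) ('X - (t z i)%:P)) ^+ totient m.
  move=> rz; rewrite rmorphXn /= -hF // r4 // => i k io km.
  by rewrite tinv.
have phi0 : (0 < totient m)%N by rewrite totient_gt0.
have sr z : size (\prod_(i <- r) ('X - (t z i)%:P)) = (size r).+1 by rewrite size_prod_XsubC.
have mr z : \prod_(i <- r) ('X - (t z i)%:P) \is monic by apply: monic_prod_XsubC.
have mF' : F ^+ (m != 2).+1 \is monic by rewrite monic_exp.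
have sF : size (F ^+ (m != 2).+1) = ((totient m).-1.+1 * size r).+1.
  by rewrite -(size_spec_monic z0 mF') prodE // (size_monic_exp _ (mr z0) (sr z0)) prednK.
have [Phi [mPhi sPhi hPhi]] := power_root_family R[i] mF' sF.
have PhiE z : range alpha z -> spec z Phi = \prod_(i <- r) ('X - (t z i)%:P).
  by move=> rz; apply: hPhi => //; rewrite prodE // prednK.
exists Phi; split.
- by rewrite monic_map.
- rewrite size_map_inj_poly ?rmorph0 ?sPhi //=; last exact: map_poly_inj.
  have t0 : (totient m)%:R != 0 :> rat by rewrite pnatr_eq0 -lt0n.
  (* [size r * totient m] and [totient m * psi m] both count the elements of order m in (Z/m)^2. *)
  apply: (mulfI t0); rewrite /psi -jordan2_totient // -card_order_set_pairs -r3.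
  by rewrite natrM mulrC.
move=> x y; rewrite horner_specialization.
have rx : range alpha (alpha x) by exists x.
have ry : range alpha (alpha y) by exists y.
rewrite PhiE // cyclic_isogeny_mcurve.
rewrite -(big_map (t (alpha x)) xpredT (fun w => 'X - w%:P)); split=> [/rootP|[phi cphi]].
  rewrite root_prod_XsubC => /mapP[i /r1 io e].
  have [y0 [phi [te cphi _]]] := ht _ i rx io.
  have iso : enhanced_iso y0 y by apply/(Defs.inv_inj alpha); rewrite e.
  by have [psi [cpsi _]] := cyclic_isogeny_post iso cphi; exists psi.
have [_ deg [P kP] _] := cphi.
(* Conversely, a kernel generator has order m, and the representative [j] of its subgroup has the
   same target. *)
have oP : has_order P m by apply: card_cyclic_span_order; rewrite -kP.
have [i Pi] := torsion_division_pair ((proj2 oP m).2 (dvdnn m)).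
have io : i \in Omega by apply/(division_pair_order (mcurve mo (alpha x))); rewrite -Pi.
have yt : alpha y = t (alpha x) i by rewrite tV //; apply: hV cphi _; rewrite // kP Pi.
have [j jr [k km ij]] := r2 i io.
apply/rootP; rewrite root_prod_XsubC; apply/mapP; exists j => //.
by rewrite yt ij tinv ?r1.
Qed.

End Degree.
End ModularPolynomial.

Theorem theorem3p1 (R : realType) (N : nat) (hN : (1 <= N)%N) (G : level)
    (alpha : modular_invariant R G N)
    (hgood : exists mo : model alpha, good_model mo)
    (m : nat) (hm : (0 < m)%N) (hmN : coprime m N) :
  exists Phi : {poly {poly rat}},
    is_modular_polynomial alpha m (map_poly (map_poly ratr) Phi).
Proof.
have [mo gmo] := hgood.
case: m hm hmN => [//|[|q]] _ mN; first exact: modular_polynomial_1 gmo.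
by have := modular_polynomial_ge2 hN gmo mN.
Qed.
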